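(* Let $Z_1,Z_2$ be limit permutations and let $(\sigma_n)_{n\in\mathbb{N}}$ be a convergent permutation sequence with $\sigma_n\to Z_1$. Then $\sigma_n\to Z_2$ if and only if the set $\{x\in[0,1]: Z_1(x,\cdot)\not\equiv Z_2(x,\cdot)\}$ has Lebesgue measure zero.
   Context: A permutation is a bijection $\sigma:[n]\to[n]$, $[n]=\{1,\dots,n\}$, $n\ge1$. For a totally ordered set $A$, $A^m_<$ denotes the set of strictly increasing $m$-tuples of elements of $A$. Subpermutation density: for permutations $\tau$ of $[k]$ and $\pi$ of $[n]$, $\Lambda(\tau,\pi)$ is the number of $(x_1,\dots,x_k)\in[n]^k_<$ such that, for all $i,j$, $\pi(x_i)<\pi(x_j)$ if and only if $\tau(i)<\tau(j)$; $t(\tau,\pi)=\binom nk^{-1}\Lambda(\tau,\pi)$ if $k\le n$, and $t(\tau,\pi)=0$ if $k>n$. A permutation sequence $(\sigma_n)$ is convergent if, for every fixed permutation $\tau$, the real sequence $(t(\tau,\sigma_n))_n$ converges. A cdf is a non-decreasing left-continuous function $F:[0,1]\to[0,1]$ with $F(0)=0$. Its associated measure is the Borel probability measure $\mu_F$ on $[0,1]$ with $\mu_F([0,1])=1$ and $\mu_F([a,b))=F(b)-F(a)$ for $0\le a<b\le1$; $\int\cdots dF_1\cdots dF_m$ denotes integration against $\mu_{F_1}\times\cdots\times\mu_{F_m}$. A limit permutation is a Lebesgue measurable function $Z:[0,1]^2\to[0,1]$ such that (a) for every $x\in[0,1]$, $Z(x,\cdot)$ is a cdf, continuous at $0$, with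 $Z(x,1)=1$; (b) for every $y\in[0,1]$, $\int_0^1Z(x,y)\,dx=y$. For a permutation $\tau$ of $[m]$ and a limit permutation $Z$, $$t(\tau,Z)=m!\int_{[0,1]^m_<}\Big(\int_{[0,1]^m_<}dZ(x_{\tau^{-1}(1)},\cdot)\cdots dZ(x_{\tau^{-1}(m)},\cdot)\Big)dx_1\cdots dx_m,$$ where in the inner integral over $(y_1,\dots,y_m)\in[0,1]^m_<$ the variable $y_i$ is integrated against the measure of the cdf $Z(x_{\tau^{-1}(i)},\cdot)$ (so $t(\tau,Z)=1$ when $m=1$). $\sigma_n\to Z$ means $\lim_{n\to\infty}t(\tau,\sigma_n)=t(\tau,Z)$ for every permutation $\tau$. *)

(* Defs.v *)
From HB Require Import structures.
From mathcomp Require Import all_boot all_order all_algebra all_fingroup.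
From mathcomp Require Import all_classical all_reals all_analysis.
From mathcomp Require Import measurable_realfun.

Set Implicit Arguments.
Unset Strict Implicit.
Unset Printing Implicit Defensive.

Import Order.TTheory GRing.Theory Num.Theory.
Import numFieldNormedType.Exports.

Local Open Scope classical_set_scope.
Local Open Scope ring_scope.

(* Permutations of [n] are elements of 'S_n, i.e. permutations of {0,...,n-1};
   the requirement n >= 1 is stated wherever a permutation is quantified. *)

Definition occurrences (k n : nat) (tau : 'S_k) (pi : 'S_n) :
    {set {ffun 'I_k -> 'I_n}} :=
  [set x : {ffun 'I_k -> 'I_n} |
    [forall i : 'I_k, forall j : 'I_k, (i < j)%N ==> (x i < x j)%N] &&
    [forall i : 'I_k, forall j : 'I_k,
       (pi (x i) < pi (x j))%N == (tau i < tau j)%N]].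

Definition perm_density (R : realType) (k n : nat) (tau : 'S_k) (pi : 'S_n) : R :=
  if (k <= n)%N then #|occurrences tau pi|%:R / 'C(n, k)%:R else 0.

Definition convergent_perm_seq (R : realType) (len : nat -> nat)
    (sigma : forall n, 'S_(len n)) : Prop :=
  forall (k : nat) (tau : 'S_k), (0 < k)%N ->
    cvgn (fun n => perm_density R tau (sigma n)).

(* Functions on [0, 1] and [0, 1]^2 are represented by functions on the whole
   line and plane, whose values outside [0, 1] and [0, 1]^2 play no role. *)

Record is_cdf (R : realType) (F : R -> R) : Prop := IsCdf {
  cdf_range : forall y : R, 0 <= y <= 1 -> 0 <= F y <= 1 ;
  cdf_nondecr : forall y1 y2 : R, 0 <= y1 -> y1 <= y2 -> y2 <= 1 -> F y1 <= F y2 ;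
  cdf_left_cont : forall y : R, 0 < y <= 1 -> F z @[z --> y^'-] --> F y ;
  cdf_at0 : F 0 = 0 }.

Definition is_cdf_measure (R : realType) (F : R -> R)
    (mu : probability (measurableTypeR R) R) : Prop :=
  mu `[0, 1]%classic = 1%E /\
  forall a b : R, 0 <= a -> a < b -> b <= 1 -> mu `[a, b[%classic = (F b - F a)%:E.

(* The measure of a cdf, as a Borel probability measure on the line that is
   concentrated on [0, 1] (junk value \d_0 if F is not a cdf); see
   cdf_measureP. *)
Definition cdf_measure (R : realType) (F : R -> R) :
    probability (measurableTypeR R) R :=
  xget (dirac (0 : measurableTypeR R) : probability (measurableTypeR R) R)
    [set mu | is_cdf_measure F mu].

Lemma cdf_measureP (R : realType) (F : R -> R) :
  is_cdf F -> is_cdf_measure F (cdf_measure F).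
Proof.
move=> [Fr Fnd Flc F0].
pose E (y : R) := if y <= 0 then 0 else if y <= 1 then F y else 1.
have E0 y : y <= 0 -> E y = 0 by rewrite /E => ->.
have E1 y : 1 < y -> E y = 1.
  by move=> y1; rewrite /E !leNgt y1 (lt_trans _ y1).
have EF y : 0 <= y <= 1 -> E y = F y.
  move=> /andP[y0 y1]; rewrite /E y1; case: ltgtP y0 => // <- _.
  by rewrite F0.
have Er y : 0 <= E y <= 1.
  rewrite /E; case: (leP y 0) => y0; first by rewrite lexx ler01.
  by case: (leP y 1) => y1; [rewrite Fr// y1 ltW|rewrite ler01 lexx].
have End : {homo E : x y / x <= y}.
  move=> x y xy; have [x0|x0] := leP x 0.
    by rewrite (E0 x)//; case/andP: (Er y).
  have [y1|y1] := leP y 1; last by rewrite (E1 y)//; case/andP: (Er x).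
  have x1 := le_trans xy y1.
  rewrite !EF ?x1 ?y1 ?(ltW x0)//; last by rewrite (le_trans _ xy)// ltW.
  by apply: Fnd => //; exact: ltW.
have Elc y : E z @[z --> y^'-] --> E y.
  have [y0|y0] := leP y 0.
    apply: cvg_near_cst; near=> z; rewrite !E0//.
    by rewrite (le_trans _ y0)// ltW//; near: z; exact: nbhs_left_lt.
  have [y1|y1] := leP y 1.
    rewrite EF ?y1 ?ltW//; apply: cvg_trans (Flc y _); last by rewrite y0.
    apply: near_eq_cvg; near=> z.
    have z0 : 0 < z by near: z; exact: nbhs_left_gt.
    have zy : z < y by near: z; exact: nbhs_left_lt.
    by rewrite EF// (ltW z0) (le_trans (ltW zy) y1).
  apply: cvg_near_cst; near=> z.
  have z1 : 1 < z by near: z; exact: nbhs_left_gt.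
  by rewrite !E1.
pose G (x : R) : R := 1 - E (- x).
have Gnd : nondecreasing G.
  by move=> x y xy; rewrite /G lerD2l lerN2; apply: End; rewrite lerN2.
have Grc : right_continuous G.
  move=> x; apply: cvgB; first exact: cvg_cst.
  have := (cvg_at_leftNP E (- x) (E (- x))).1 (Elc _).
  by rewrite opprK.
have GNy : G x @[x --> -oo] --> (0 : R).
  apply: cvg_near_cst; near=> x; have x1 : x < - 1 by near: x; exact: nbhs_ninfty_lt.
  by rewrite /G E1 ?subrr// ltrNr.
have Gy : G x @[x --> +oo] --> (1 : R).
  apply: cvg_near_cst; near=> x; have x0 : 0 <= x by near: x; exact: nbhs_pinfty_ge.
  by rewrite /G E0 ?subr0// oppr_le0.
pose Gc1 := isCumulative.Build R _ R G Gnd Grc.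
pose Gc2 := isCumulativeBounded.Build R 0 1 G GNy Gy.
pose GC : cumulative R R := HB.pack G Gc1.
pose GB : cumulativeBounded (0:R) (1:R) := HB.pack G Gc1 Gc2.
pose ls : probability (measurableTypeR R) R := lebesgue_stieltjes_measure GB.
have lsE a b : a <= b -> ls `]a, b]%classic = (G b - G a)%:E.
  move=> ab; have -> : ls `]a, b]%classic = (wlength G)^*%mu `]a, b]%classic by [].
  rewrite (measurable_mu_extE (wlength GC))/=; last exact: is_ocitv.
  by rewrite wlength_itv_bnd.
have ls0 : ls `]-2, -1[%classic = 0%E.
  rewrite itv_bnd_open_bigcup; apply: measure_negligible.
    by apply: bigcup_measurable => k _; exact: measurable_itv.
  apply: negligible_bigcup => k; apply/negligibleP; first exact: measurable_itv.
  have k0 : (0 : R) < k.+1%:R^-1 by rewrite invr_gt0.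
  have [ab|ab] := leP (-2 : R) (-1 - k.+1%:R^-1).
    rewrite [LHS](lsE _ _ ab) /G !E1 ?subrr// ?opprK ?ltr1n//.
    by rewrite opprD !opprK ltrDl.
  by rewrite set_itv_ge ?measure0// bnd_simp -leNgt ltW.
have mN : measurable_fun [set: measurableTypeR R] (-%R : R -> measurableTypeR R).
  exact: oppr_measurable.
pose mu0 : {measure set (measurableTypeR R) -> \bar R} :=
  measure_function_pushforward__canonical__measure_function_Measure ls mN.
have mu0T : mu0 setT = 1%E.
  by rewrite /mu0 /= /pushforward preimage_setT probability_setT.
pose muM := Measure_isProbability.Build _ _ _ _ mu0T.
pose mu : probability (measurableTypeR R) R :=
  HB.pack (Measure.sort mu0) (Measure.class mu0) muM.
suff muF : is_cdf_measure F mu.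
  exact: (@xgetPex _ _ [set nu | is_cdf_measure F nu] (ex_intro _ mu muF)).
have muE A : mu A = ls (-%R @^-1` A) by [].
split=> [|a b a0 ab b1]; rewrite muE.
  rewrite (_ : _ @^-1` _ = `[-1, 0]%classic); last first.
    by apply/seteqP; split => x /=; rewrite !in_itv/= oppr_ge0 lerNl andbC.
  have : ls `]-2, 0]%classic = 1%E.
    rewrite lsE ?oppr_le0// /G oppr0 opprK E0// E1 ?ltr1n//.
    by rewrite subr0 subrr subr0.
  have -> : (`]-2, 0] = `]-2, -1[ `|` `[-1, 0] :> set R)%classic.
    apply/seteqP; split => x /=; rewrite !in_itv/=.
      by move=> /andP[-> ->]; rewrite andbT; have [|] := ltP x (-1); [left|right].
    move=> [/andP[-> x1]|/andP[x1 ->]] /=.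
      by rewrite (le_trans (ltW x1))// oppr_le0.
    by rewrite andbT (lt_le_trans _ x1)// ltrN2 ltr1n.
  rewrite measureU//; first by rewrite [X in (X + _)%E = _]ls0 add0e.
  apply/seteqP; split => x //=; rewrite !in_itv/=.
  by move=> [/andP[_ x1] /andP[]]; rewrite leNgt x1.
rewrite (_ : _ @^-1` _ = `]- b, - a]%classic); last first.
  by apply/seteqP; split => x /=; rewrite !in_itv/= ltrNl lerNr andbC.
rewrite lsE ?lerN2 ?(ltW ab)// /G !opprK !EF ?a0 ?b1 ?(le_trans a0 (ltW ab))//.
  by congr EFin; rewrite opprB addrC addrA subrK.
by rewrite (le_trans (ltW ab)).
Unshelve. all: by end_near. Qed.

(* The product measure mu_0 x ... x mu_(n-1) on n-tuples, obtained by iterating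
   the binary product along the bijection T * T^n ~ T^n.+1; see tuple_measureP for the
   product rule on boxes. *)
Fixpoint tuple_measure d (T : measurableType d) (R : realType) (n : nat) :
    ('I_n -> set T -> \bar R) -> set (n.-tuple T) -> \bar R :=
  match n return ('I_n -> set T -> \bar R) -> set (n.-tuple T) -> \bar R with
  | 0 => fun _ => dirac [tuple]
  | n'.+1 => fun mu =>
      pushforward (mu ord0 \x tuple_measure (fun i => mu (lift ord0 i)))%E
        (fun p : T * n'.-tuple T => [tuple of p.1 :: p.2])
  end.

Lemma tuple_measureP d (T : measurableType d) (R : realType) (n : nat)
    (mu : 'I_n -> {sigma_finite_measure set T -> \bar R}) :
  exists2 m : {sigma_finite_measure set (n.-tuple T) -> \bar R},
    tuple_measure (fun i => mu i) = m &
    forall A : 'I_n -> set T, (forall i, measurable (A i)) ->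
      m [set x | forall i, A i (tnth x i)] = (\prod_(i < n) mu i (A i))%E.
Proof.
elim: n mu => [|n IHn] mu.
  exists (dirac ([tuple] : 0.-tuple T)) => // A mA.
  by rewrite big_ord0 [LHS]/= diracE mem_set// => -[].
have [m mE mA] := IHn (fun i => mu (lift ord0 i)).
pose f (p : T * n.-tuple T) : n.+1.-tuple T := [tuple of p.1 :: p.2].
have mf : measurable_fun [set: (T * n.-tuple T)%type] f.
  apply: (@measurable_cons _ _ _ _ fst n snd).
  - exact: measurable_fst.
  - exact: measurable_snd.
pose nu : {measure set (n.+1.-tuple T) -> \bar R} :=
  measure_function_pushforward__canonical__measure_function_Measure
    (mu ord0 \x m)%E mf.
have nuE (A : 'I_n.+1 -> set T) : (forall i, measurable (A i)) ->
    nu [set x | forall i, A i (tnth x i)] = (\prod_(i < n.+1) mu i (A i))%E.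
  move=> mAi; rewrite big_ord_recl -mA//.
  rewrite -product_measure1E//; last first.
    rewrite (_ : [set x | _] =
        \bigcap_(i in [set: 'I_n]) ((fun x => tnth x i) @^-1` A (lift ord0 i))).
      apply: fin_bigcap_measurable => // i _.
      by rewrite -[X in measurable X]setTI; exact: measurable_tnth.
    by apply/seteqP; split => x /= h; [move=> i _; exact: h|move=> i; exact: h].
  rewrite /nu /= /pushforward; congr (product_measure1 _ _ _).
  apply/seteqP; split => -[t x] /=.
    by move=> h; split; [exact: (h ord0)|move=> i; have := h (lift ord0 i);
      rewrite tnthS].
  by move=> [h0 h] i; case: (unliftP ord0 i) => [j ->|->]; rewrite ?tnthS.
have nuS : sigma_finite [set: n.+1.-tuple T] nu.
  have /sigma_finiteP[F [TF ndF Foo]] := sigma_finiteT (mu ord0).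
  have /sigma_finiteP[H [TH ndH Hoo]] := sigma_finiteT m.
  pose g (x : n.+1.-tuple T) : T * n.-tuple T := (thead x, [tuple of behead x]).
  have mg : measurable_fun [set: n.+1.-tuple T] g.
    apply/measurable_fun_pair; first exact: measurable_tnth.
    exact: measurable_behead.
  have fK p : g (f p) = p.
    by case: p => t x; congr (_, _); apply: val_inj.
  exists (fun k => g @^-1` (F k `*` H k)).
    apply/esym; rewrite -subTset => x _.
    have [k _ Fk] : (\bigcup_k F k) (g x).1 by rewrite -TF.
    have [l _ Hl] : (\bigcup_k H k) (g x).2 by rewrite -TH.
    exists (maxn k l) => //; split.
      by move: Fk; exact/subsetPset/ndF/leq_maxl.
    by move: Hl; exact/subsetPset/ndH/leq_maxr.
  move=> k; have [mF Fk] := Foo k; have [mH Hk] := Hoo k; split.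
    by rewrite -[X in measurable X]setTI; apply: mg => //; exact: measurableX.
  rewrite /nu /= /pushforward (_ : f @^-1` _ = F k `*` H k).
    by rewrite product_measure1E// lte_mul_pinfty// ge0_fin_numE.
  by apply/seteqP; split => p; rewrite /preimage /mkset fK.
pose nuM := Measure_isSigmaFinite.Build _ _ _ _ nuS.
pose nu' : {sigma_finite_measure set (n.+1.-tuple T) -> \bar R} :=
  HB.pack (Measure.sort nu) (Measure.class nu) nuM.
exists nu' => //=.
by rewrite mE.
Qed.

Definition simplex (R : realType) (m : nat) : set (m.-tuple R) :=
  [set x | (forall i, 0 <= tnth x i <= 1) /\
           forall i j : 'I_m, (i < j)%N -> tnth x i < tnth x j].

Definition unit_itv (R : realType) : set R := `[0, 1].
Arguments unit_itv R : clear implicits.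

(* The Lebesgue sigma-algebra of the plane is obtained by completing the Borel
   one; measurability for the uncompleted product would be a stronger
   requirement. *)
Definition lebesgue_plane (R : realType) :=
  g_sigma_algebraType
    (completed_algebra_gen (@lebesgue_measure R \x @lebesgue_measure R)%E).

Record limit_permutation (R : realType) (Z : R -> R -> R) : Prop :=
  LimitPermutation {
  limperm_measurable :
    @measurable_fun _ _ (lebesgue_plane R) R
      (unit_itv R `*` unit_itv R) (fun p => Z p.1 p.2) ;
  limperm_cdf : forall x : R, 0 <= x <= 1 -> is_cdf (Z x) ;
  limperm_cont0 : forall x : R, 0 <= x <= 1 -> Z x y @[y --> 0^'+] --> Z x 0 ;
  limperm_at1 : forall x : R, 0 <= x <= 1 -> Z x 1 = 1 ;
  limperm_integral : forall y : R, 0 <= y <= 1 ->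
    (\int[@completed_lebesgue_measure R]_(x in unit_itv R) (Z x y)%:E)%E = y%:E }.

(* The outer integral is against the product of the completed Lebesgue
   measures, because x |-> cdf_measure (Z x) is only Lebesgue measurable.
   Both integrals are bounded by 1, so that fine is harmless. *)
Definition limit_density (R : realType) (m : nat) (tau : 'S_m)
    (Z : R -> R -> R) : R :=
  m`!%:R * fine
    (\int[tuple_measure (fun _ : 'I_m => @completed_lebesgue_measure R)]_(
        x in (@simplex R m : set _))
       \int[tuple_measure (fun i : 'I_m => cdf_measure (Z (tnth x ((tau^-1)%g i))))]_(
          y in (@simplex R m : set _)) 1)%E.

Definition perm_seq_tends_to (R : realType) (len : nat -> nat)
    (sigma : forall n, 'S_(len n)) (Z : R -> R -> R) : Prop :=
  forall (m : nat) (tau : 'S_m), (0 < m)%N ->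
    perm_density R tau (sigma n) @[n --> \oo] --> limit_density tau Z.

(* Main.v *)
Require Import Defs.
From HB Require Import structures.
From mathcomp Require Import all_boot all_order all_algebra all_fingroup.
From mathcomp Require Import all_classical all_reals all_analysis.
From mathcomp Require Import measurable_realfun lra.

Set Implicit Arguments.
Unset Strict Implicit.
Unset Printing Implicit Defensive.

Import Order.TTheory GRing.Theory Num.Theory.
Import numFieldNormedType.Exports.

Local Open Scope classical_set_scope.
Local Open Scope ring_scope.

(** A limit permutation Z disintegrates a probability measure mu_Z on the unit
square: the mass of A x B is the integral over x in A of the mass that the
measure of the cdf Z(x, .) gives to B.  Its marginals are uniform, the first
by construction and the second by the integral condition on Z.  Draw m
independent points from mu_Z.  Their relative order is a random permutation,
and t(tau, Z) is the probability that it equals tau: this is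
[limit_densityE], where m! accounts for sorting the points by abscissa.  So
the theorem says that the laws of these random patterns determine, and are
determined by, the kernel x |-> Z(x, .) up to a null set.

Patterns determine mixed moments ([moments_of_patterns]).  Since the marginals
are uniform, x^a y^b is the conditional probability, given a sample point
(x, y), that the next a points of the sample lie to the left of it and the b
points after those lie below it.  Whether this happens can be read off from
the two linear orders on the sample given by the abscissas and by the
ordinates.  Hence, up to ties, which have probability 0, the event is a
disjoint union of events that prescribe both orders, and by exchangeability
([sorted_by_perm]) the probability of each of those is a pattern probability.

Moments determine masses ([moments_below]).  The polynomials (1 - x^n)^k with
k = floor(n / c^n) lie between 0 and 1 on [0, 1] and converge there pointwise
to the indicator of [0, c[, so by dominated convergence the moments determine
the mass below every threshold c.  This is used twice.  In the variable x,
with the moment of order b of Z(x, .) as weight, it shows that these moments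
agree for almost every x, simultaneously for all b; in the variable y, for
each such x, it shows that Z1(x, .) = Z2(x, .) ([equal_densities_ae]).

Conversely, if Z1(x, .) = Z2(x, .) for almost every x, the two measures on the
square coincide ([permuton_eq]), hence so do all densities.

Measurability needs some care, because Z is only Lebesgue measurable in the
plane: a priori x |-> Z(x, y) is measurable for almost every y only.  Left
continuity in y extends this to every y ([measurable_sections]), and this is
what makes x |-> Z(x, .) a probability kernel on the completed Lebesgue space. *)

(** * Product measures on tuples *)

Section tuple_sets.
Context d (T : measurableType d).

Definition box n (A : 'I_n -> set T) : set (n.-tuple T) :=
  [set x | forall i, A i (tnth x i)].

Lemma measurable_box n (A : 'I_n -> set T) :
  (forall i, measurable (A i)) -> measurable (box A).
Proof.
move=> mA; rewrite (_ : box A =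
    \bigcap_(i in [set: 'I_n]) ((fun x => tnth x i) @^-1` A i)).
  apply: fin_bigcap_measurable => // i _.
  by rewrite -[X in measurable X]setTI; exact: measurable_tnth.
by apply/seteqP; split => x /= h; [move=> i _; exact: h|move=> i; exact: h].
Qed.

(** Boxes form a pi-system, so that a measure on tuples is determined by the
    product rule; this is the reason for generating the sigma-algebra by them. *)
Lemma measurable_tuple_boxE n : @measurable _ (n.-tuple T) =
  <<s [set @box n A | A in [set A | forall i, measurable (A i)]] >>.
Proof.
apply/seteqP; split; last first.
  apply: smallest_sub; first exact: sigma_algebra_measurable.
  by move=> _ [A mA <-]; exact: measurable_box.
apply: smallest_sub; first exact: smallest_sigma_algebra.
rewrite -bigcup_seq/= => _ [i _ [B mB <-]]; rewrite setTI.
apply: sub_sigma_algebra; exists (fun j => if j == i then B else setT).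
  by move=> j /=; case: ifP.
apply/seteqP; split => x /=; first by move/(_ i); rewrite eqxx.
by move=> Bx j; case: eqP => // ->.
Qed.

Definition tuple_cons n (t : T) (x : n.-tuple T) : n.+1.-tuple T :=
  [tuple of t :: x].

Lemma measurable_tuple_cons n :
  measurable_fun [set: (T * n.-tuple T)%type] (fun p => tuple_cons p.1 p.2).
Proof. by apply: (@measurable_cons _ _ _ _ fst n snd). Qed.

Definition reindex_tuple n (s : 'I_n -> 'I_n) (x : n.-tuple T) : n.-tuple T :=
  [tuple tnth x (s i) | i < n].

Lemma measurable_reindex_tuple n (s : 'I_n -> 'I_n) :
  measurable_fun [set: n.-tuple T] (reindex_tuple s).
Proof.
apply/measurable_fun_tnthP => i /=.
rewrite (_ : _ \o _ = (fun x => tnth x (s i))); first exact: measurable_tnth.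
by apply/funext => x /=; rewrite tnth_mktuple.
Qed.

End tuple_sets.

Section tuple_measures.
Context d (T : measurableType d) (R : realType).
Local Open Scope ereal_scope.

(** [tuple_measure] is a mere set function; this is the same function with
    its measure structure, which [tuple_measureP] only asserts to exist. *)
Definition tuple_sfm n (mu : 'I_n -> {sigma_finite_measure set T -> \bar R}) :
  {sigma_finite_measure set (n.-tuple T) -> \bar R} :=
  projT1 (cid2 (tuple_measureP mu)).

Lemma tuple_sfmE n (mu : 'I_n -> {sigma_finite_measure set T -> \bar R}) :
  tuple_measure (fun i => mu i) = tuple_sfm mu.
Proof. by rewrite /tuple_sfm; case: cid2. Qed.

Lemma tuple_sfm_box n (mu : 'I_n -> {sigma_finite_measure set T -> \bar R}) A :
  (forall i, measurable (A i)) -> tuple_sfm mu (box A) = \prod_(i < n) mu i (A i).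
Proof. by rewrite /tuple_sfm; case: cid2 => m /= _; exact. Qed.

Lemma tuple_sfm0 (mu : 'I_0 -> {sigma_finite_measure set T -> \bar R}) :
  tuple_sfm mu = dirac [tuple] :> (set _ -> _).
Proof. by rewrite -tuple_sfmE. Qed.

(** [tuple_measure] is an iterated binary product, so that Tonelli's theorem
    peels off the first coordinate; inductions on the length rest on this. *)
Lemma integral_tuple_sfm_cons n
    (mu : 'I_n.+1 -> {sigma_finite_measure set T -> \bar R})
    (f : n.+1.-tuple T -> \bar R) :
  (forall x, 0 <= f x) -> measurable_fun setT f ->
  \int[tuple_sfm mu]_x f x =
  \int[mu ord0]_t \int[tuple_sfm (fun i => mu (lift ord0 i))]_x f (tuple_cons t x).
Proof.
move=> f0 mf; rewrite -tuple_sfmE /= (tuple_sfmE (fun i => mu (lift ord0 i))).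
rewrite (ge0_integral_pushforward (@measurable_tuple_cons _ T n))//.
rewrite preimage_setT fubini_tonelli1//.
  by apply: measurableT_comp => //; exact: measurable_tuple_cons.
by move=> p; exact: f0.
Qed.

End tuple_measures.

Section tuple_probabilities.
Context d (T : measurableType d) (R : realType).
Local Open Scope ereal_scope.
Implicit Types n : nat.

Lemma tuple_sfm_setT n (mu : 'I_n -> probability T R) :
  tuple_sfm (fun i => mu i) setT = 1.
Proof.
rewrite (_ : setT = box (fun=> setT)); last by apply/seteqP; split.
by rewrite tuple_sfm_box// big1// => i _; exact: probability_setT.
Qed.

Definition tprob n (mu : 'I_n -> probability T R) :
    probability (n.-tuple T) R :=
  HB.pack (Measure.sort (tuple_sfm (fun i => mu i)))
    (Measure.class (tuple_sfm (fun i => mu i)))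
    (Measure_isProbability.Build _ _ _ _ (tuple_sfm_setT mu)).

Arguments tprob : simpl never.

Lemma tprobE n (mu : 'I_n -> probability T R) :
  tuple_measure (fun i => mu i) = tprob mu.
Proof. by rewrite tuple_sfmE. Qed.

Lemma tprob_box n (mu : 'I_n -> probability T R) A :
  (forall i, measurable (A i)) -> tprob mu (box A) = \prod_(i < n) mu i (A i).
Proof. exact: (tuple_sfm_box (fun i => mu i)). Qed.

Lemma integral_tprob_cons n (mu : 'I_n.+1 -> probability T R)
    (f : n.+1.-tuple T -> \bar R) :
  (forall x, 0 <= f x) -> measurable_fun setT f ->
  \int[tprob mu]_x f x =
  \int[mu ord0]_t \int[tprob (fun i => mu (lift ord0 i))]_x f (tuple_cons t x).
Proof. exact: (integral_tuple_sfm_cons (fun i => mu i)). Qed.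

Lemma tprob_unique n (mu : 'I_n -> probability T R)
    (m : {measure set (n.-tuple T) -> \bar R}) :
  (forall A, (forall i, measurable (A i)) ->
    m (box A) = \prod_(i < n) mu i (A i)) ->
  forall U, measurable U -> m U = tprob mu U.
Proof.
move=> mA U mU.
have setTE : [set: n.-tuple T] = box (fun=> setT) by apply/seteqP; split.
apply: (@measure_unique _ _ _ _ (fun=> setT) (@measurable_tuple_boxE _ T n)).
- move=> _ _ [A mmA <-] [B mB <-]; exists (fun i => A i `&` B i) => /=.
    by move=> i; exact: measurableI.
  apply/seteqP; split => x /=; first by move=> h; split=> i; case: (h i).
  by move=> [h1 h2] i; split; [exact: h1|exact: h2].
- by move=> _; rewrite setTE; exists (fun=> setT).
- by rewrite bigcup_const.
- by move=> _ [A mmA <-]; rewrite mA//; apply/esym; exact: tprob_box.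
- move=> _ ; rewrite setTE mA ?big1 ?ltry// => i _.
  exact: probability_setT.
- by [].
Qed.

(** Both sides are measures on tuples with the same value on boxes.  For a
    constant family this is the exchangeability of independent samples. *)
Lemma tprob_perm n (mu : 'I_n -> probability T R) (s : 'S_n) U :
  measurable U ->
  tprob (fun i => mu (s i)) U = tprob mu (reindex_tuple s @^-1` U).
Proof.
move=> mU; have ms := @measurable_reindex_tuple _ T n s.
pose m : {measure set (n.-tuple T) -> \bar R} :=
  measure_function_pushforward__canonical__measure_function_Measure
    (tprob mu) ms.
rewrite -[RHS]/(m U); apply/esym/tprob_unique => // A mA.
rewrite /m /= /pushforward.
rewrite (_ : _ @^-1` _ = box (fun i => A ((s^-1)%g i))).
  transitivity (\prod_(i < n) mu i (A ((s^-1)%g i))); first exact: tprob_box.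
  by rewrite (reindex_perm s)/=; apply: eq_bigr => i _; rewrite permK.
apply/seteqP; split => x /= h i.
  by have := h ((s^-1)%g i); rewrite tnth_mktuple permKV.
by rewrite tnth_mktuple; have := h (s i); rewrite permK.
Qed.

Lemma tprob_cons n (mu : 'I_n.+1 -> probability T R) U : measurable U ->
  tprob mu U =
  \int[mu ord0]_t tprob (fun i => mu (lift ord0 i)) (tuple_cons t @^-1` U).
Proof.
move=> mU; have mtU t : measurable (tuple_cons t @^-1` U).
  rewrite -[X in measurable X]setTI.
  exact: (measurableT_comp (@measurable_tuple_cons _ T n) (measurable_pair1 t)).
rewrite -[in LHS](setIT U) -integral_indic// integral_tprob_cons//.
- apply: eq_integral => t _; rewrite -[in RHS](setIT (_ @^-1` _)).
  by rewrite -integral_indic//.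
- exact/measurable_EFinP.
Qed.

End tuple_probabilities.

(** * Sorting permutations *)

Section sorting.
Context (R : realType) (n : nat).
Implicit Types (f g : 'I_n -> R) (s : 'S_n).

Definition increasing f := forall i j : 'I_n, (i < j)%N -> f i < f j.

Lemma increasing_mono f : increasing f ->
  forall i j : 'I_n, (f i < f j) = (i < j)%N.
Proof.
move=> fi i j; case: ltnP => [/fi //|ij]; apply/negbTE; rewrite -leNgt.
by move: ij; rewrite leq_eqVlt => /orP[/eqP/val_inj ->//|/fi/ltW].
Qed.

Lemma increasing_sorted f : increasing f ->
  sorted <%R [seq f i | i <- enum 'I_n].
Proof.
move=> fi; rewrite sorted_map.
suff : sorted ltn [seq val i | i <- enum 'I_n].
  by rewrite sorted_map; apply: sub_sorted => i j /fi.
by rewrite val_enum_ord iota_ltn_sorted.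
Qed.

(** Two increasing enumerations of the same finite set of reals coincide, and
    the values of [f] are pairwise distinct. *)
Lemma increasing_perm_unique f s1 s2 :
  increasing (f \o s1) -> increasing (f \o s2) -> s1 = s2.
Proof.
move=> f1 f2.
have f_inj : injective f.
  move=> i j fij; apply: (@perm_inj _ s1^-1%g).
  have [lt|lt|/val_inj//] := ltngtP ((s1^-1)%g i) ((s1^-1)%g j).
    by have := f1 _ _ lt; rewrite /= !permKV fij ltxx.
  by have := f1 _ _ lt; rewrite /= !permKV fij ltxx.
have : [seq (f \o s1) i | i <- enum 'I_n] = [seq (f \o s2) i | i <- enum 'I_n].
  apply: lt_sorted_eq; [exact: increasing_sorted|exact: increasing_sorted|].
  move=> y; apply/mapP/mapP => -[i _ ->].
    exists ((s2^-1)%g (s1 i)); rewrite ?mem_enum//=.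
    by rewrite permKV.
  exists ((s1^-1)%g (s2 i)); rewrite ?mem_enum//=.
  by rewrite permKV.
move/eq_in_map => h; apply/permP => i.
by apply: f_inj; apply: h; rewrite mem_enum.
Qed.

Lemma increasing_perm_exists f : injective f ->
  exists s, increasing (f \o s).
Proof.
move=> f_inj; pose t := [tuple f i | i < n].
have /tuple_permP[s ts] : perm_eq (sort <=%R t) t by rewrite perm_sort.
exists s => i j ij.
have nE k : nth 0 (sort <=%R t) (val k) = f (s k).
  rewrite ts/= (nth_map k) ?size_enum_ord// nth_ord_enum.
  by rewrite tnth_mktuple.
rewrite /= -!nE; apply: (sorted_ltn_nth lt_trans) => //.
- rewrite sort_lt_sorted /t /= map_inj_uniq//; exact: enum_uniq.
- by rewrite inE size_sort (size_tuple t) (ltn_ord i).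
- by rewrite inE size_sort (size_tuple t) (ltn_ord j).
Qed.

(** The sorting permutation carries all the information on comparisons, so
    that two families that it sorts are compared alike. *)
Lemma increasing_perm_lt f g s : increasing (f \o s) -> increasing (g \o s) ->
  forall i j, (f i < f j) = (g i < g j).
Proof.
move=> fs gs i j; rewrite -(permKV s i) -(permKV s j).
by rewrite -/((f \o s) _) -/((f \o s) _) increasing_mono//
  -(increasing_mono gs).
Qed.

End sorting.

(** * Pattern probabilities determine mixed moments *)

Section comparison_sets.
Context d (T : measurableType d) (R : realType) (f g : T -> R).
Hypotheses (mf : measurable_fun setT f) (mg : measurable_fun setT g).

Lemma measurable_ltr_set : measurable [set t | f t < g t].
Proof.
have mtrue : measurable ([set true] : set bool) by [].
have := measurable_fun_ltr mf mg measurableT mtrue.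
by rewrite setTI preimage_true.
Qed.

Lemma measurable_eqr_set : measurable [set t | f t = g t].
Proof.
have mtrue : measurable ([set true] : set bool) by [].
have := measurable_fun_eqr mf mg measurableT mtrue.
rewrite setTI preimage_true; congr measurable.
by apply/seteqP; split => t /eqP.
Qed.

End comparison_sets.

Section coordinates.
Context d (T : measurableType d) (R : realType) (u v : T -> R).
Hypothesis mfu : measurable_fun setT u.
Hypothesis mfv : measurable_fun setT v.
Local Open Scope ereal_scope.

(** The coordinates take values in [R]; working inside the square keeps track
    of the part of [T] where they lie in [0, 1]. *)
Definition square : set T := [set t | 0 <= u t <= 1 /\ 0 <= v t <= 1]%R.

(** The samples in the square whose first coordinates are sorted by [a] and
    second coordinates by [b].  They are free of ties and have the relative
    order of the permutation [(b * a^-1)^-1]. *)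
Definition sorted_by n (a b : 'S_n) : set (n.-tuple T) :=
  [set x | (forall i, square (tnth x i)) /\
    increasing (fun i => u (tnth x (a i))) /\
    increasing (fun i => v (tnth x (b i)))].

Lemma measurable_between (f : T -> R) : measurable_fun setT f ->
  measurable [set t | (0 <= f t <= 1)%R].
Proof.
move=> mf; rewrite -[X in measurable X]setTI.
rewrite (_ : [set t | _] = f @^-1` `[0%R, 1%R]).
  exact: mf.
by apply/seteqP; split => t /=; rewrite in_itv.
Qed.

Lemma measurable_below (f : T -> R) (c : R) : measurable_fun setT f ->
  measurable [set t | (f t < c)%R].
Proof.
move=> mf; rewrite -[X in measurable X]setTI.
rewrite (_ : [set t | _] = f @^-1` `]-oo, c[); first exact: mf.
by apply/seteqP; split => t /=; rewrite in_itv.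
Qed.

Lemma measurable_square : measurable square.
Proof.
rewrite (_ : square =
    [set t | (0 <= u t <= 1)%R] `&` [set t | (0 <= v t <= 1)%R]).
  by apply: measurableI; exact: measurable_between.
by [].
Qed.

Lemma measurable_increasing n (f : T -> R) (a : 'I_n -> 'I_n) :
  measurable_fun setT f ->
  measurable [set x : n.-tuple T | increasing (fun i => f (tnth x (a i)))].
Proof.
move=> mf; rewrite (_ : [set x | _] = \bigcap_(i in [set: 'I_n])
   \bigcap_(j in [set j : 'I_n | (i < j)%N])
     [set x | (f (tnth x (a i)) < f (tnth x (a j)))%R]).
  apply: fin_bigcap_measurable => // i _; apply: fin_bigcap_measurable => // j _.
  have mt k : measurable_fun [set: n.-tuple T] (fun x => f (tnth x k)).
    exact: (measurableT_comp mf (measurable_tnth k)).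
  exact: measurable_ltr_set.
by apply/seteqP; split => x /= h; [move=> i _ j ij|move=> i j ij]; exact: h.
Qed.

Lemma measurable_sorted_by n (a b : 'S_n) : measurable (sorted_by a b).
Proof.
rewrite (_ : sorted_by a b = box (fun=> square) `&`
   ([set x | increasing (fun i => u (tnth x (a i)))] `&`
    [set x | increasing (fun i => v (tnth x (b i)))])) //.
apply: measurableI; first by apply: measurable_box => _; exact: measurable_square.
by apply: measurableI; exact: measurable_increasing.
Qed.


Section pattern_moments.
Variable m : probability T R.

Definition uniform_coord (f : T -> R) : Prop :=
  forall c : R, (0 <= c <= 1)%R -> m (square `&` [set t | (f t < c)%R]) = c%:E.

Hypotheses (um : uniform_coord u) (vm : uniform_coord v).

Let iid n : probability (n.-tuple T) R := tprob (fun _ : 'I_n => m).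

(** An atom at [c] would be a jump of the distribution function, which is
    the identity on [0, 1]. *)
Lemma uniform_coord_atomless (f : T -> R) (c : R) : measurable_fun setT f ->
  (forall t, square t -> (0 <= f t <= 1)%R) -> uniform_coord f ->
  m (square `&` [set t | f t = c]) = 0.
Proof.
move=> mf fsq fm; have msq := measurable_square.
have meq : measurable [set t | f t = c].
  by rewrite -[X in measurable X]setTI; exact: (mf _ _ (measurable_set1 c)).
have [/andP[c0 c1]|c01] := boolP (0 <= c <= 1)%R; last first.
  rewrite (_ : _ `&` _ = set0) ?measure0//.
  by apply/seteqP; split => // t [/fsq + /= fc]; rewrite fc (negbTE c01).
apply/eqP; rewrite eq_le measure_ge0 andbT; apply/lee_addgt0Pr => e e0.
(* adding the mass [c] below [c] turns the claim into a bound by [c + e] *)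
rewrite add0e -(@leeD2lE _ c%:E)// -[leLHS]/(c%:E + _).
rewrite -(fm c) ?c0// -measureU//; last 3 first.
- by apply: measurableI => //; exact: measurable_below.
- exact: measurableI.
- apply/seteqP; split => // t [[_ /= +] [_ /= fc]].
  by rewrite fc ltxx.
rewrite fm ?c0//.
have [ce|ce] := leP (c + e)%R 1%R; last first.
  apply: (@le_trans _ _ 1%E); last by rewrite -EFinD lee_fin ltW.
  apply: probability_le1; apply: measurableU; apply: measurableI => //.
  exact: measurable_below.
rewrite -EFinD -(fm (c + e)%R) ?ce ?addr_ge0// ?(ltW e0)//.
apply: le_measure; rewrite ?inE//.
- apply: measurableU; apply: measurableI => //.
  exact: measurable_below.
- by apply: measurableI => //; exact: measurable_below.
- move=> t [[st /= fc]|[st /= fc]]; split => //=.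
    by rewrite (lt_trans fc)// ltrDl.
  by rewrite fc ltrDl.
Qed.

(** By exchangeability one of the two indices may be taken to be the first one;
    conditionally on the first point, a tie with it asks another point to lie in
    a null set. *)
Lemma ties_null n (f : T -> R) (i j : 'I_n) : measurable_fun setT f ->
  (forall t, square t -> (0 <= f t <= 1)%R) -> uniform_coord f -> i != j ->
  iid n [set x | (forall k, square (tnth x k)) /\ f (tnth x i) = f (tnth x j)]
    = 0.
Proof.
case: n i j => [[]//|n] i j mf fsq fm ij.
have msq := measurable_square.
pose U (k l : 'I_n.+1) : set (n.+1.-tuple T) :=
  [set x | (forall k, square (tnth x k)) /\ f (tnth x k) = f (tnth x l)].
have mU k l : measurable (U k l).
  rewrite (_ : U k l = box (fun=> square) `&`
      [set x | f (tnth x k) = f (tnth x l)])//.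
  apply: measurableI; first exact: measurable_box.
  have mt h : measurable_fun [set: n.+1.-tuple T] (fun x => f (tnth x h)).
    exact: (measurableT_comp mf (measurable_tnth h)).
  exact: measurable_eqr_set.
(* transposing [ord0] and [i] brings the tie to the first point *)
pose s := tperm ord0 i.
have s0 : s ord0 = i by rewrite tpermL.
have sK k : s (s k) = k by rewrite tpermK.
have /(unlift_some)[k sjE _] : ord0 != s j.
  by apply: contra ij => /eqP e; rewrite -(sK j) -e s0.
transitivity (iid n.+1 (U ord0 (s j))).
  rewrite [RHS](tprob_perm (fun=> m) s (mU _ _)).
  congr (iid n.+1 _); apply/seteqP; split => x /= [sx fx].
    split => [h|]; first by rewrite tnth_mktuple.
    by rewrite !tnth_mktuple s0 sK.
  split => [h|]; first by rewrite -(sK h); have := sx (s h); rewrite tnth_mktuple.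
  by move: fx; rewrite !tnth_mktuple s0 sK.
rewrite /iid tprob_cons//= integral0_eq// => t _.
pose A (l : 'I_n) : set T := square `&` [set t' | l = k -> f t' = f t].
have mA l : measurable (A l).
  apply: measurableI => //; have [->|lk] := eqVneq l k.
    rewrite (_ : [set _ | _] = f @^-1` [set f t]).
      by rewrite -[X in measurable X]setTI; exact: mf.
    by apply/seteqP; split => t' /= h; [exact: h|move=> _].
  rewrite (_ : [set _ | _] = setT)//.
  by apply/seteqP; split => t' //= _ /eqP; rewrite (negbTE lk).
apply/eqP; rewrite eq_le measure_ge0 andbT.
apply: (@le_trans _ _ (tprob (fun=> m) (box A))).
  apply: le_measure; rewrite ?inE.
  - rewrite -[X in measurable X]setTI.
    by apply: (measurableT_comp (@measurable_tuple_cons _ T n) (measurable_pair1 t)).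
  - exact: measurable_box.
  - move=> x [sx fx] l; split => /=; first by have := sx (lift ord0 l); rewrite tnthS.
    by move=> ->; move: fx; rewrite sjE tnthS.
rewrite tprob_box// (bigD1 k)//=.
rewrite (_ : A k = square `&` [set t' | f t' = f t]).
  by rewrite uniform_coord_atomless// mul0e.
by apply/seteqP; split => t' [? /= h]; split => //=; exact: h.
Qed.


(** Exchangeability: relabelling the sample by [a] sorts its first
    coordinates, and only the order of the second ones relative to the first
    ones matters. *)
Lemma sorted_by_perm n (a b : 'S_n) :
  iid n (sorted_by a b) = iid n (sorted_by 1%g (b * a^-1)%g).
Proof.
rewrite [RHS](tprob_perm (fun=> m) a (measurable_sorted_by _ _)).
congr (iid n _); apply/seteqP; split => x /= [sx [ux vx]].
  split; [|split] => [i|i j ij|i j ij]; rewrite !tnth_mktuple ?perm1.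
  - exact: sx.
  - exact: ux.
  - by rewrite !permM !permKV; exact: vx.
split; [|split] => [i|i j ij|i j ij].
- by have := sx ((a^-1)%g i); rewrite tnth_mktuple permKV.
- by have := ux _ _ ij; rewrite !tnth_mktuple !perm1.
- by have := vx _ _ ij; rewrite !tnth_mktuple !permM !permKV.
Qed.

(** The event that encodes a mixed moment: each point after the first one lies
    to the left of it or below it, as prescribed by [c]. *)
Definition dominated n (c : 'I_n -> bool) : set (n.+1.-tuple T) :=
  [set x | (forall i, square (tnth x i)) /\ forall i : 'I_n,
    if c i then (u (tnth x (lift ord0 i)) < u (tnth x ord0))%R
    else (v (tnth x (lift ord0 i)) < v (tnth x ord0))%R].

Lemma measurable_dominated n (c : 'I_n -> bool) : measurable (dominated c).
Proof.
rewrite (_ : dominated c = box (fun=> square) `&`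
  \bigcap_(i in [set: 'I_n]) (if c i
     then [set x | (u (tnth x (lift ord0 i)) < u (tnth x ord0))%R]
     else [set x | (v (tnth x (lift ord0 i)) < v (tnth x ord0))%R])).
  apply: measurableI; first by apply: measurable_box => _; exact: measurable_square.
  apply: fin_bigcap_measurable => // i _.
  have mt (f : T -> R) h : measurable_fun setT f ->
      measurable_fun [set: n.+1.-tuple T] (fun x => f (tnth x h)).
    by move=> mf; exact: (measurableT_comp mf (measurable_tnth h)).
  by case: (c i); apply: measurable_ltr_set; exact: mt.
apply/seteqP; split => x /= -[sx h]; split => // i.
  by move=> _; have := h i; case: (c i).
by have := h i Logic.I; case: (c i).
Qed.

(** Given the first point [t], the other points are independent, and each of
    them satisfies its constraint with probability [u t] or [v t] because the
    coordinates are uniform. *)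
Lemma dominated_moment n (c : 'I_n -> bool) :
  iid n.+1 (dominated c) =
  \int[m]_(t in square) (\prod_(i < n) (if c i then u t else v t))%:E.
Proof.
rewrite /iid tprob_cons; last exact: measurable_dominated.
rewrite [RHS]integral_mkcond; apply: eq_integral => t _.
rewrite patchE; case: ifPn => [/set_mem st|/negP nst]; last first.
  rewrite (_ : _ @^-1` _ = set0) ?measure0//.
  apply/seteqP; split => // x [/(_ ord0) st _]; apply: nst.
  exact/mem_set.
pose A (i : 'I_n) := square `&` (if c i then [set t' | (u t' < u t)%R]
  else [set t' | (v t' < v t)%R]).
have mA i : measurable (A i).
  apply: measurableI; first exact: measurable_square.
  by case: (c i); exact: measurable_below.
rewrite (_ : _ @^-1` _ = box A).
  rewrite tprob_box// -prodEFin; apply: eq_bigr => i _; rewrite /A.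
  by case: (c i); [exact: um st.1|exact: vm st.2].
apply/seteqP; split => x /=.
  move=> [sx h] i; split; first by have := sx (lift ord0 i); rewrite tnthS.
  by have := h i; rewrite tnthS; case: (c i).
move=> h; split => [i|i].
  by case: (unliftP ord0 i) => [j ->|->]; rewrite ?tnthS//; case: (h j).
by rewrite tnthS; have [_] := h i; case: (c i).
Qed.

Lemma sorted_by_disjoint n :
  trivIset setT (fun p : 'S_n * 'S_n => sorted_by p.1 p.2).
Proof.
move=> [a b] [a' b'] _ _ [x [/= [_ [ux vx]] [_ [ux' vx']]]].
congr pair.
  exact: (@increasing_perm_unique _ _ (fun i => u (tnth x i))).
exact: (@increasing_perm_unique _ _ (fun i => v (tnth x i))).
Qed.

(** Membership in [dominated c] only depends on how the two coordinates
    compare the points, hence on the pair of sorting permutations.  So the event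
    is, up to ties, the disjoint union of the classes [sorted_by a b] that it
    contains.  The index set of the sum does not involve the measure, and
    this is what allows two measures to be compared term by term. *)
Lemma dominated_patterns n (c : 'I_n -> bool) :
  iid n.+1 (dominated c) =
  \sum_(p \in [set p : 'S_n.+1 * 'S_n.+1 |
               sorted_by p.1 p.2 `<=` dominated c])
    iid n.+1 (sorted_by p.1 p.2).
Proof.
set S := [set p : 'S_n.+1 * 'S_n.+1 | sorted_by p.1 p.2 `<=` dominated c].
pose V := \bigcup_(p in S) sorted_by p.1 p.2.
have finS : finite_set S by exact: finite_finset.
have mV : measurable V.
  by apply: fin_bigcup_measurable => // p _; exact: measurable_sorted_by.
transitivity (iid n.+1 V); last first.
  rewrite /V measure_fin_bigcup//.
  - by apply: sub_trivIset (@sorted_by_disjoint n.+1).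
  - by move=> p _; exact: measurable_sorted_by.
(* [N ((i, j), b)]: points [i] and [j] tie in the coordinate selected by [b] *)
pose N (p : ('I_n.+1 * 'I_n.+1) * bool) : set (n.+1.-tuple T) :=
  if p.1.1 == p.1.2 then set0 else
  [set x | (forall k, square (tnth x k)) /\
    (if p.2 then u else v) (tnth x p.1.1) =
    (if p.2 then u else v) (tnth x p.1.2)].
have N0 p : (iid n.+1).-negligible (N p).
  rewrite /N; case: eqVneq => [_|ij]; first exact: negligible_set0.
  have mf : measurable_fun setT (if p.2 then u else v) by case: p.2.
  have fsq t : square t -> (0 <= (if p.2 then u else v) t <= 1)%R.
    by case: p.2 => -[].
  have fm : uniform_coord (if p.2 then u else v) by case: p.2.
  apply/negligibleP; last exact: ties_null.
  rewrite (_ : [set x | _] = box (fun=> square) `&`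
     [set x | (if p.2 then u else v) (tnth x p.1.1) =
    (if p.2 then u else v) (tnth x p.1.2)])//.
  apply: measurableI; first by apply: measurable_box => _; exact: measurable_square.
  have mt h : measurable_fun [set: n.+1.-tuple T]
      (fun x => (if p.2 then u else v) (tnth x h)).
    exact: (measurableT_comp mf (measurable_tnth h)).
  exact: measurable_eqr_set.
have NN : (iid n.+1).-negligible (\big[setU/set0]_p N p).
  elim/big_ind : _ => [|A B|p _]; [exact: negligible_set0| |exact: N0].
  exact: negligibleU.
have VE : V `<=` dominated c by move=> x [p Sp] /Sp.
have mEV : measurable (dominated c `\` V).
  by apply: measurableD => //; exact: measurable_dominated.
have mEV0 : iid n.+1 (dominated c `\` V) = 0; last first.
  by rewrite -[in LHS](setDUK VE) measureU0.
apply: measure_negligible => //; apply: negligibleS NN => x [[sx xc] nVx].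
rewrite -bigcup_seq; apply: contrapT => nNx; apply: nVx.
have inj (b : bool) :
    injective (fun i : 'I_n.+1 => (if b then u else v) (tnth x i)).
  move=> i j fij; apply/eqP/negP => /negP ij; apply: nNx.
  exists ((i, j), b) => /=; first by rewrite mem_index_enum.
  by rewrite /N/= (negbTE ij).
have [a ua] := increasing_perm_exists (inj true).
have [b vb] := increasing_perm_exists (inj false).
exists (a, b) => //= y [sy [uy vy]]; split => // i.
have := xc i; case: (c i).
  by rewrite (increasing_perm_lt ua (g := fun i => u (tnth y i)) uy).
by rewrite (increasing_perm_lt vb (g := fun i => v (tnth y i)) vy).
Qed.

End pattern_moments.

(** The moment of order [(a, b)] is the
    probability of a [dominated] event for [a + b] additional points, and
    that event is a union of patterns. *)
Theorem moments_of_patterns (m1 m2 : probability T R) :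
  uniform_coord m1 u -> uniform_coord m1 v ->
  uniform_coord m2 u -> uniform_coord m2 v ->
  (forall n (s : 'S_n.+1), tprob (fun=> m1) (sorted_by 1%g s) =
                           tprob (fun=> m2) (sorted_by 1%g s)) ->
  forall a b : nat,
    \int[m1]_(t in square) (u t ^+ a * v t ^+ b)%:E =
    \int[m2]_(t in square) (u t ^+ a * v t ^+ b)%:E.
Proof.
move=> um1 vm1 um2 vm2 m12 a b.
pose c (i : 'I_(a + b)) := (i < a)%N.
have prodE t : (\prod_(i < a + b) (if c i then u t else v t))%R =
    (u t ^+ a * v t ^+ b)%R.
  rewrite big_split_ord/= /c; congr (_ * _)%R.
    under eq_bigr => i _ do rewrite /= ltn_ord.
    by rewrite prodr_const card_ord.
  under eq_bigr => i _ do rewrite /= ltnNge leq_addr/=.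
  by rewrite prodr_const card_ord.
under eq_integral do rewrite -prodE.
under [RHS]eq_integral do rewrite -prodE.
rewrite -!dominated_moment// !dominated_patterns//.
by apply: eq_fsbigr => p _; rewrite sorted_by_perm m12 -sorted_by_perm.
Qed.

End coordinates.

(** * Moments determine the mass below a threshold *)

Section threshold_polynomials.
Context (R : realType).
Implicit Types (x y c : R) (n k : nat).

(** The exponent [k] is chosen so that [k x^n] tends to 0 for [x < c] and to
    infinity for [c <= x].  The factor [n] serves the case [x = c], where it
    makes the limit 0 rather than the inverse of e. *)
Definition threshold_poly c n : {poly R} :=
  (1 - 'X^n) ^+ Num.truncn (n%:R * c ^- n).

Lemma threshold_polyE c n x :
  (threshold_poly c n).[x] = (1 - x ^+ n) ^+ Num.truncn (n%:R * c ^- n).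
Proof. by rewrite /threshold_poly !hornerE. Qed.

Lemma threshold_poly01 c n x : 0 <= x <= 1 ->
  0 <= (threshold_poly c n).[x] <= 1.
Proof.
move=> /andP[x0 x1]; rewrite threshold_polyE.
have xn0 : 0 <= x ^+ n by exact: exprn_ge0.
have xn1 : x ^+ n <= 1 by exact: exprn_ile1.
by rewrite exprn_ge0 ?subr_ge0// exprn_ile1// ?subr_ge0// lerBlDr lerDl.
Qed.

Lemma bernoulli_le y k : -1 <= y -> 1 + k%:R * y <= (1 + y) ^+ k.
Proof.
move=> y1; elim: k => [|k IHk]; first by rewrite mul0r addr0 expr0.
rewrite exprS (le_trans _ (ler_wpM2l _ IHk))//; last by lra.
have : 0 <= k%:R * y ^+ 2 by rewrite mulr_ge0// sqr_ge0.
rewrite -natr1; lra.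
Qed.

(** Multiply the Bernoulli bound [1 + k y <= (1 + y)^k] by [(1 - y)^k]. *)
Lemma exp_le_inv y k : 0 <= y <= 1 -> (1 - y) ^+ k * (1 + k%:R * y) <= 1.
Proof.
move=> /andP[y0 y1]; have h : 0 <= (1 - y) ^+ k by rewrite exprn_ge0// subr_ge0.
apply: (@le_trans _ _ ((1 - y) ^+ k * (1 + y) ^+ k)).
  by apply: ler_wpM2l => //; apply: bernoulli_le; lra.
by rewrite -exprMn exprn_ile1//; [nra|have := sqr_ge0 y; nra].
Qed.

(** With [w] the square root of [z], the Bernoulli inequality bounds [n w^n],
    and the remaining factor [w^n] tends to 0. *)
Lemma cvg_natrM_expr z : 0 <= z < 1 -> n%:R * z ^+ n @[n --> \oo] --> (0 : R).
Proof.
move=> /andP[z0 z1]; have [->|zN0] := eqVneq z 0.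
  apply: cvg_near_cst; near=> n; rewrite expr0n.
  have n0 : (0 < n)%N by near: n; exact: nbhs_infty_gt.
  by rewrite gtn_eqF// mulr0.
pose w := Num.sqrt z.
have w0 : 0 < w by rewrite sqrtr_gt0 lt_neqAle eq_sym zN0.
have w1 : w < 1 by rewrite -sqrtr1 ltr_sqrt.
have wz : z = w ^+ 2 by rewrite sqr_sqrtr.
pose h := w^-1 - 1.
have h0 : 0 < h by rewrite subr_gt0 invf_gt1.
have nw n : n%:R * w ^+ n <= h^-1.
  have wn0 : 0 < w ^+ n by exact: exprn_gt0.
  have hw : 1 + h = w^-1 by rewrite /h; lra.
  have : 1 + n%:R * h <= (w ^+ n)^-1.
    by rewrite -exprVn -hw; apply: bernoulli_le; lra.
  rewrite -div1r ler_pdivlMr// => H.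
  rewrite -div1r ler_pdivlMr//; nra.
have lim0 : h^-1 * w ^+ n @[n --> \oo] --> (0 : R).
  by apply: cvg_geometric; rewrite gtr0_norm.
apply: (@squeeze_cvgr _ _ _ _ (fun=> 0) (fun n => h^-1 * w ^+ n)).
- apply: nearW => n; rewrite mulr_ge0 ?exprn_ge0//= wz -exprM mulnC exprM expr2.
  by rewrite mulrA ler_wpM2r// exprn_ge0// ltW.
- exact: cvg_cst.
- exact: lim0.
Unshelve. all: by end_near. Qed.

(** Below [c] the Bernoulli inequality gives [1 - k x^n <= (1 - x^n)^k <= 1]
    and [k x^n <= n (x / c)^n]; from [c] on, [exp_le_inv] bounds the polynomial
    by [1 / (1 + k x^n)], which is at most [1 / n]. *)
Lemma threshold_poly_cvg c x : 0 < c -> 0 <= x <= 1 ->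
  (threshold_poly c n).[x] @[n --> \oo] --> ((x < c)%R%:R : R).
Proof.
move=> c0 x01; have /andP[x0 x1] := x01.
have kP n : (Num.truncn (n%:R * c ^- n))%:R <= n%:R * c ^- n <
    (Num.truncn (n%:R * c ^- n)).+1%:R.
  by apply: truncn_itv; rewrite mulr_ge0// invr_ge0 exprn_ge0// ltW.
have [xc|cx] := ltP x c.
  apply: (@squeeze_cvgr _ _ _ _ (fun n => 1 - n%:R * (x / c) ^+ n) (fun=> 1)).
  - apply: nearW => n; have /andP[_ ->] := threshold_poly01 c n x01.
    rewrite andbT threshold_polyE.
    have xn1 : x ^+ n <= 1 by exact: exprn_ile1.
    have xn0 : 0 <= x ^+ n by exact: exprn_ge0.
    have := @bernoulli_le (- x ^+ n) (Num.truncn (n%:R * c ^- n)).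
    rewrite lerN2 => /(_ xn1); apply: le_trans.
    rewrite mulrN lerD2l lerN2 expr_div_n mulrA mulrAC ler_wpM2r//.
    by have /andP[] := kP n.
  - rewrite -[X in _ --> X](subr0 1); apply: cvgB; first exact: cvg_cst.
    apply: cvg_natrM_expr; rewrite divr_ge0 ?(ltW c0)//=.
    by rewrite ltr_pdivrMr// mul1r.
  - exact: cvg_cst.
apply: (@squeeze_cvgr _ _ _ _ (fun=> 0) (fun n => n%:R^-1)).
- near=> n; have /andP[-> _] /= := threshold_poly01 c n x01.
  have n0 : (0 < n)%N by near: n; exact: nbhs_infty_gt.
  have xn01 : 0 <= x ^+ n <= 1 by rewrite exprn_ge0// exprn_ile1.
  rewrite threshold_polyE -[leRHS]div1r ler_pdivlMr ?ltr0n//.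
  apply: le_trans (exp_le_inv (Num.truncn (n%:R * c ^- n)) xn01).
  apply: ler_wpM2l.
    by rewrite exprn_ge0// subr_ge0; case/andP: xn01.
  have cn0 : 0 < c ^+ n by exact: exprn_gt0.
  have cxn : c ^+ n <= x ^+ n by apply: lerXn2r => //; rewrite nnegrE// ltW.
  have /andP[_] := kP n; rewrite ltr_pdivrMr// -natr1.
  move: (Num.truncn _)%:R (ler0n R (Num.truncn (n%:R * c ^- n))) => k k0.
  have /andP[_ xn1] := xn01.
  have : k * c ^+ n <= k * x ^+ n by exact: ler_wpM2l.
  have : c ^+ n <= 1 by exact: le_trans cxn xn1.
  nra.
- exact: cvg_cst.
- by rewrite -cvg_shiftS; exact: cvg_harmonic.
Unshelve. all: by end_near. Qed.

End threshold_polynomials.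

Section moments_below.
Context d (T : measurableType d) (R : realType) (D : set T) (u : T -> R).
Hypotheses (mD : measurable D) (mfu : measurable_fun D u).
Hypothesis u01 : forall t, D t -> 0 <= u t <= 1.
Local Open Scope ereal_scope.

Lemma measurable_horner (p : {poly R}) : measurable_fun D (fun t => p.[u t]%R).
Proof.
apply: (@measurableT_comp _ _ _ _ _ _ (horner p)) => //.
by apply: continuous_measurable_fun; exact: continuous_horner.
Qed.

Section one_measure.
Variables (m : probability T R) (g : T -> R).
Hypotheses (mg : measurable_fun D g) (g01 : forall t, D t -> (0 <= g t <= 1)%R).

Lemma integrable_weighted (f : T -> R) : measurable_fun D f ->
  (forall t, D t -> `|f t| <= 1)%R -> m.-integrable D (fun t => (f t * g t)%:E).
Proof.
move=> mf f1.
apply: (@measurable_bounded_integrable _ _ _ _ (fun t => f t * g t)%R) => //.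
- by apply: le_lt_trans (ltry 1); exact: probability_le1.
- exact: measurable_funM.
- exists 1%R; split => // M M1 t Dt /=; rewrite (le_trans _ (ltW M1))//.
  rewrite normrM; have /andP[g0 g1] := g01 Dt; rewrite (ger0_norm g0).
  by rewrite -[leRHS]mulr1 ler_pM// f1.
Qed.

Lemma integral_horner (p : {poly R}) :
  \int[m]_(t in D) (p.[u t] * g t)%:E =
  \sum_(i < size p) (p`_i)%:E * \int[m]_(t in D) (u t ^+ i * g t)%:E.
Proof.
have iu i : m.-integrable D (fun t => (u t ^+ i * g t)%:E).
  apply: integrable_weighted; first exact: measurable_funX.
  move=> t Dt; have /andP[u0 u1] := u01 Dt.
  by rewrite ger0_norm ?exprn_ge0// exprn_ile1.
transitivity (\int[m]_(t in D) (\sum_(i < size p) (p`_i)%:E * (u t ^+ i * g t)%:E)).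
  apply: eq_integral => t _; rewrite horner_coef big_distrl/= -sumEFin.
  by apply: eq_bigr => i _; rewrite -EFinM mulrA.
rewrite integral_sum//; last by move=> i; exact: integrableZl.
by apply: eq_bigr => i _; rewrite integralZl.
Qed.

Lemma integral_threshold_cvg (c : R) : (0 < c)%R ->
  \int[m]_(t in D) ((threshold_poly c n).[u t] * g t)%:E @[n --> \oo] -->
  \int[m]_(t in D `&` [set t | (u t < c)%R]) (g t)%:E.
Proof.
move=> c0.
rewrite integral_mkcondr.
have mlt : measurable_fun D (fun t => (u t < c)%R%:R : R).
  rewrite (_ : (fun t => _) = \1_(`]-oo, c[ : set R) \o u)%R.
    exact: measurableT_comp.
  by apply/funext => t /=; rewrite indicE mem_setE in_itv.
have -> : \int[m]_(t in D) ((fun t => (g t)%:E) \_ [set t | (u t < c)%R]) t =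
   \int[m]_(t in D) ((u t < c)%R%:R * g t)%:E.
  apply: eq_integral => t _; rewrite patchE; case: ifPn => [/set_mem/= ->|].
    by rewrite mul1r.
  by move=> /negP; case: ltP => [? []|_ _]; [exact/mem_set|rewrite mul0r].
have [|||||_ _ h] := @dominated_convergence _ T R m D mD
  (fun n t => ((threshold_poly c n).[u t] * g t)%:E)
  (fun t => ((u t < c)%R%:R * g t)%:E) (cst 1); last exact: h.
- by move=> n; apply/measurable_EFinP/measurable_funM => //; exact: measurable_horner.
- by apply/measurable_EFinP/measurable_funM.
- apply: aeW => t Dt; apply: cvg_EFin; first exact: nearW.
  by apply: cvgM; [apply: threshold_poly_cvg => //; exact: u01|exact: cvg_cst].
- exact: finite_measure_integrable_cst.
- apply: aeW => t n Dt; rewrite lee_fin.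
  have /andP[p0 p1] := threshold_poly01 c n (u01 Dt).
  have /andP[g0 g1] := g01 Dt.
  by rewrite ger0_norm ?mulr_ge0// -[leRHS]mulr1 ler_pM.
Qed.

End one_measure.

(** By linearity the hypothesis extends to polynomials in [u], in particular to
    the threshold polynomials, whose integrals converge to the integrals below
    the threshold by dominated convergence.  The weights [g1] and [g2]
    allow the same statement to serve for the measure of a cdf (weight 1) and for
    the kernel moments as functions of the abscissa (same measure, different
    weights). *)
Theorem moments_below (m1 m2 : probability T R) (g1 g2 : T -> R) :
  measurable_fun D g1 -> (forall t, D t -> (0 <= g1 t <= 1)%R) ->
  measurable_fun D g2 -> (forall t, D t -> (0 <= g2 t <= 1)%R) ->
  (forall i, \int[m1]_(t in D) (u t ^+ i * g1 t)%:E =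
             \int[m2]_(t in D) (u t ^+ i * g2 t)%:E) ->
  forall c : R, \int[m1]_(t in D `&` [set t | (u t < c)%R]) (g1 t)%:E =
                \int[m2]_(t in D `&` [set t | (u t < c)%R]) (g2 t)%:E.
Proof.
move=> mg1 g101 mg2 g201 g12 c; have [c0|c0] := ltP 0%R c; last first.
  rewrite (_ : D `&` _ = set0) ?integral_set0//.
  apply/seteqP; split => // t [/u01/andP[u0 _] /=].
  by rewrite ltNge (le_trans c0).
have /cvg_lim <- // := integral_threshold_cvg (m := m1) mg1 g101 c0.
have /cvg_lim <- // := integral_threshold_cvg (m := m2) mg2 g201 c0.
apply: congr_lim; apply/funext => n; rewrite !integral_horner//.
by apply: eq_bigr => i _; rewrite g12.
Qed.

End moments_below.

(** * Probability kernels and their joint laws *)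

Section kernel_measurability.
Context d1 d2 (X : measurableType d1) (Y : measurableType d2) (R : realType).
Variable K : X -> pprobability Y R.
Local Open Scope ereal_scope.

(** The sigma-algebra on the space of probabilities is generated by the
    evaluations at measurable sets. *)
Lemma measurable_kernelP :
  (forall U, measurable U -> measurable_fun setT (fun x => K x U)) ->
  measurable_fun setT K.
Proof.
move=> mK; apply: (@measurability _ _ _ _ setT K (@pset _ Y R)) => //.
move=> _ [_ [r _ [U mU <-]] <-]; rewrite setTI.
rewrite (_ : _ @^-1` _ = (fun x => K x U) @^-1` `]-oo, r%:E[).
  by rewrite -[X in measurable X]setTI; apply: mK => //; exact: emeasurable_itv.
by apply/seteqP; split => x /=; rewrite /mset in_itv.
Qed.

Lemma measurable_kernel_eval U : measurable_fun setT K -> measurable U ->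
  measurable_fun setT (fun x => K x U).
Proof. by move=> mK; exact: (measurable_kernel (kprobability mK)). Qed.

Lemma measurable_kernel_generated (G : set (set Y)) :
  measurable = <<s G >> -> setI_closed G ->
  (forall U, G U -> measurable_fun setT (fun x => K x U)) ->
  measurable_fun setT K.
Proof.
move=> GE GI GK; apply: measurable_kernelP => U.
rewrite GE; move: U.
apply: (@dynkin_induction _ _ _
  (fun U => measurable_fun setT (fun x => K x U))) => //.
- rewrite (_ : (fun x => _) = cst 1)//.
  by apply/funext => x; exact: probability_setT.
- move=> U mU mKU; rewrite (_ : (fun x => _) = (fun x => 1 - K x U)).
    by apply: emeasurable_funB.
  by apply/funext => x; exact: probability_setC.
- move=> F mF tF mKF; rewrite (_ : (fun x => _) =
      (fun x => \sum_(0 <= k <oo) K x (F k))).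
    by apply: ge0_emeasurable_sum => // k _ x _; exact: measure_ge0.
  apply/funext => x; apply/esym/cvg_lim => //.
  exact: measure_semi_sigma_additive (mF) (tF) (bigcup_measurable (fun k _ => mF k)).
Qed.

End kernel_measurability.

Section joint_law.
Context d1 d2 (X : measurableType d1) (Y : measurableType d2) (R : realType).
Variables (P : probability X R) (K : X -> pprobability Y R).
Hypothesis mK : measurable_fun setT K.
Local Open Scope ereal_scope.

Lemma measurable_integral_kernel (f : X * Y -> \bar R) :
  (forall p, 0 <= f p) -> measurable_fun setT f ->
  measurable_fun setT (fun x => \int[K x]_y f (x, y)).
Proof.
move=> f0 mf.
exact: (measurable_fun_integral_finite_kernel _ (kprobability mK)).
Qed.

Let graphK (p : unit * X) : {measure set (X * Y) -> \bar R} :=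
  measure_function_pushforward__canonical__measure_function_Measure
    (K p.2) (measurable_pair1 p.2 : measurable_fun _ (@pair X Y p.2)).

Let graphKT p : graphK p setT = 1.
Proof. exact: probability_setT. Qed.

Let graphP (p : unit * X) : probability (X * Y)%type R :=
  HB.pack (Measure.sort (graphK p)) (Measure.class (graphK p))
    (Measure_isProbability.Build _ _ _ _ (graphKT p)).

Let mgraphP : measurable_fun setT
  (graphP : unit * X -> pprobability (X * Y)%type R).
Proof.
apply: measurable_kernelP => U mU.
rewrite (_ : (fun p => _) =
    (fun x => \int[K x]_y (\1_U (x, y))%:E) \o snd).
  apply: measurableT_comp => //.
  apply: (@measurable_integral_kernel (fun p => (\1_U p)%:E)).
    by move=> p; rewrite lee_fin.
  exact/measurable_EFinP.
apply/funext => p /=; rewrite integral_indic//= ?setIT//.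
rewrite -[X in measurable X]setTI.
exact: (measurable_pair1 p.2).
Qed.

Let mcstP : measurable_fun setT (cst P : unit -> pprobability X R).
Proof. exact: measurable_cst. Qed.

Let jointm : {measure set (X * Y) -> \bar R} :=
  (kprobability mcstP \; kprobability mgraphP) tt.

Let jointmT : jointm setT = 1.
Proof.
rewrite /jointm /mkcomp /= /kcomp.
under eq_integral do rewrite graphKT.
by rewrite integral_cst// mul1e; exact: (probability_setT P).
Qed.

(** The law of a pair whose first component has law [P] and whose second
    component has law [K x] given that the first one is [x].  It is obtained as
    a composition of kernels, the second of which pushes [K x] forward along
    the graph map [y |-> (x, y)]. *)
Definition joint_law : probability (X * Y)%type R :=
  HB.pack (Measure.sort jointm) (Measure.class jointm)
    (Measure_isProbability.Build _ _ _ _ jointmT).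
Arguments joint_law : simpl never.

Lemma integral_joint_law (f : X * Y -> \bar R) :
  (forall p, 0 <= f p) -> measurable_fun setT f ->
  \int[joint_law]_p f p = \int[P]_x \int[K x]_y f (x, y).
Proof.
move=> f0 mf.
rewrite [LHS](integral_kcomp (kprobability mcstP) (kprobability mgraphP) tt f0 mf).
apply: eq_integral => x _ /=.
rewrite [LHS](ge0_integral_pushforward (measurable_pair1 x))//.
Qed.

End joint_law.

Section tuple_kernel.
Context d1 d2 (X : measurableType d1) (Y : measurableType d2) (R : realType).
Variable K : X -> pprobability Y R.
Hypothesis mK : measurable_fun setT K.
Local Open Scope ereal_scope.

Definition tuple_kernel n (x : n.-tuple X) : pprobability (n.-tuple Y) R :=
  tprob (fun i => K (tnth x i)).

Lemma measurable_tuple_kernel n : measurable_fun setT (@tuple_kernel n).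
Proof.
apply: (measurable_kernel_generated (measurable_tuple_boxE Y n)).
  move=> _ _ [A mmA <-] [B mB <-]; exists (fun i => A i `&` B i) => /=.
    by move=> i; exact: measurableI.
  apply/seteqP; split => x /=; first by move=> h; split=> i; case: (h i).
  by move=> [h1 h2] i; split; [exact: h1|exact: h2].
move=> _ [A mA <-]; rewrite (_ : (fun x => _) =
    (fun x : n.-tuple X => \prod_(i < n) K (tnth x i) (A i))); last first.
  by apply/funext => x; exact: tprob_box.
elim: (index_enum 'I_n) => [|i s IHs].
  by under eq_fun do rewrite big_nil; exact: measurable_cst.
under eq_fun do rewrite big_cons; apply: emeasurable_funM => //.
exact: (measurableT_comp (measurable_kernel_eval mK (mA i)) (measurable_tnth i)).
Qed.

Definition tuple_zip n (x : n.-tuple X) (y : n.-tuple Y) : n.-tuple (X * Y) :=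
  [tuple (tnth x i, tnth y i) | i < n].

Lemma tuple_zip_cons n t s (x : n.-tuple X) (y : n.-tuple Y) :
  tuple_zip (tuple_cons t x) (tuple_cons s y) = tuple_cons (t, s) (tuple_zip x y).
Proof.
apply: eq_from_tnth => i; rewrite tnth_mktuple.
by case: (unliftP ord0 i) => [j ->|->]; rewrite ?tnthS ?tnth_mktuple.
Qed.

Lemma measurable_tuple_zip n :
  measurable_fun setT (fun p : n.-tuple X * n.-tuple Y => tuple_zip p.1 p.2).
Proof.
apply/measurable_fun_tnthP => i /=.
rewrite (_ : _ \o _ = (fun p : n.-tuple X * n.-tuple Y =>
    (tnth p.1 i, tnth p.2 i))).
  apply/measurable_fun_pair.
    exact: (measurableT_comp (measurable_tnth i) measurable_fst).
  exact: (measurableT_comp (measurable_tnth i) measurable_snd).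
by apply/funext => p /=; rewrite tnth_mktuple.
Qed.

Variables (la : {sigma_finite_measure set X -> \bar R}) (D : set X).
Variable P : probability X R.
Hypothesis mD : measurable D.
Hypothesis PE : forall f : X -> \bar R, (forall x, 0 <= f x) ->
  measurable_fun setT f -> \int[P]_x f x = \int[la]_(x in D) f x.

(** Independent pairs can be drawn by first drawing all first components and
    then, given these, all second components independently.  In the induction
    this amounts to exchanging the second component of the first pair with the
    first components of the other pairs.  The law [P] is the restriction of the
    sigma-finite measure [la] to [D]; both appear because densities integrate
    the Lebesgue measure of the whole line over a subset of the cube. *)
Lemma integral_tuple_kernel n (h : n.-tuple (X * Y) -> \bar R) :
  (forall z, 0 <= h z) -> measurable_fun setT h ->
  \int[tuple_sfm (fun _ : 'I_n => la)]_(x in box (fun=> D))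
     \int[tuple_kernel x]_y h (tuple_zip x y) =
  \int[tprob (fun _ : 'I_n => joint_law P mK)]_z h z.
Proof.
elim: n h => [|n IHn] h h0 mh.
  have mT0 d (T : measurableType d) (f : 0.-tuple T -> \bar R) :
      measurable_fun setT f.
    move=> _ U _; have [f0|f0] := pselect (U (f [tuple])).
      rewrite (_ : _ `&` _ = setT)//; apply/seteqP; split => // x _.
      by split => //=; rewrite (tuple0 x).
    rewrite (_ : _ `&` _ = set0)//; apply/seteqP; split => // x [_ /=].
    by rewrite (tuple0 x).
  rewrite (_ : box _ = setT); last by apply/seteqP; split => // x _ [].
  transitivity (h [tuple]); last first.
    by rewrite -[RHS]/(\int[tuple_sfm _]_z h z) tuple_sfm0 integral_dirac//
      diracT mul1e.
  rewrite tuple_sfm0 integral_dirac; [|exact: measurableT|exact: mT0].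
  rewrite diracE mem_set// mul1e.
  rewrite -[LHS]/(\int[tuple_sfm _]_y h (tuple_zip [tuple] y)) tuple_sfm0.
  rewrite integral_dirac; [|exact: measurableT|exact: mT0].
  by rewrite diracT mul1e; congr (h _); exact: tuple0.
have mDn k : measurable (box (fun _ : 'I_k => D)) by exact: measurable_box.
pose g (x : n.+1.-tuple X) := \int[tuple_kernel x]_y h (tuple_zip x y).
have g0 x : 0 <= g x by exact: integral_ge0.
have mg : measurable_fun setT g.
  apply: (@measurable_integral_kernel _ _ _ _ _ (@tuple_kernel n.+1)
    (@measurable_tuple_kernel n.+1) (fun p => h (tuple_zip p.1 p.2))) => //.
  exact: (measurableT_comp mh (@measurable_tuple_zip n.+1)).
rewrite -[LHS]/(\int[tuple_sfm (fun _ : 'I_n.+1 => la)]_(x in box (fun=> D)) g x).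
rewrite integral_mkcond integral_tuple_sfm_cons; last 2 first.
- by apply: erestrict_ge0 => x _; exact: g0.
- by apply/(measurable_restrictT _ (mDn _)); exact: measurable_funTS.
pose H p := \int[tprob (fun _ : 'I_n => joint_law P mK)]_z h (tuple_cons p z).
have mHc : measurable_fun setT (fun p : (X * Y) * n.-tuple (X * Y) =>
    h (tuple_cons p.1 p.2)).
  exact: (measurableT_comp mh (@measurable_tuple_cons _ _ n)).
have mH : measurable_fun setT H.
  exact: (measurable_fun_fubini_tonelli_F (m2 := tprob (fun=> joint_law P mK))
    (fun p => h (tuple_cons p.1 p.2)) mHc (fun p => h0 _)).
have H0 p : 0 <= H p by exact: integral_ge0.
transitivity (\int[la]_(t in D) \int[K t]_s H (t, s)); last first.
  rewrite integral_tprob_cons// integral_joint_law//.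
  apply/esym/PE => [x|]; first by apply: integral_ge0 => s _; exact: H0.
  exact: (measurable_integral_kernel mK H0 mH).
rewrite [RHS]integral_mkcond; apply: eq_integral => t _.
rewrite [RHS]patchE; case: ifPn => [/set_mem Dt|/negP nDt]; last first.
  apply: integral0_eq => x _; rewrite patchE ifN//.
  by apply/negP => /set_mem/(_ ord0) Dt; apply: nDt; exact/mem_set.
pose k (x : n.-tuple X) (s : Y) :=
  \int[tuple_kernel x]_y h (tuple_cons (t, s) (tuple_zip x y)).
have k0 x s : 0 <= k x s by exact: integral_ge0.
have mk : measurable_fun setT (fun p => k p.1 p.2).
  apply: (@measurable_integral_kernel _ _ _ _ _
     (fun p : n.-tuple X * Y => tuple_kernel p.1) _
     (fun q => h (tuple_cons (t, q.1.2) (tuple_zip q.1.1 q.2)))) => //.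
    exact: (measurableT_comp (@measurable_tuple_kernel n) measurable_fst).
  have mz : measurable_fun setT
      (fun q : (n.-tuple X * Y) * n.-tuple Y => tuple_zip q.1.1 q.2).
    have mq : measurable_fun setT
        (fun q : (n.-tuple X * Y) * n.-tuple Y => (q.1.1, q.2)).
      apply/measurable_fun_pair; last exact: measurable_snd.
      exact: (measurableT_comp measurable_fst measurable_fst).
    exact: (measurableT_comp (@measurable_tuple_zip n) mq).
  have mq : measurable_fun setT (fun q : (n.-tuple X * Y) * n.-tuple Y =>
      ((t, q.1.2), tuple_zip q.1.1 q.2)).
    apply/measurable_fun_pair => //; apply/measurable_fun_pair.
      exact: measurable_cst.
    exact: (measurableT_comp measurable_snd measurable_fst).
  exact: (measurableT_comp mHc mq).
pose kD := (fun p => k p.1 p.2) \_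
  (box (fun=> D) `*` [set: Y]).
have kDE x s : kD (x, s) = ((k ^~ s) \_ (box (fun=> D))) x.
  rewrite /kD !patchE; congr (if _ then _ else _).
  by apply/asbool_equiv_eq; split => [[]|].
have mDX : measurable (box (fun _ : 'I_n => D) `*` [set: Y]).
  exact: measurableX.
have mkD : measurable_fun setT kD.
  by apply/(measurable_restrictT _ mDX); exact: measurable_funTS.
have kD0 p : 0 <= kD p by apply: erestrict_ge0 => q _; exact: k0.
transitivity (\int[tuple_sfm (fun _ : 'I_n => la)]_x \int[K t]_s kD (x, s)).
  apply: eq_integral => x _; rewrite patchE.
  under [RHS]eq_integral do rewrite kDE patchE.
  have -> : (tuple_cons t x \in box (fun _ : 'I_n.+1 => D)) =
            (x \in box (fun _ : 'I_n => D)).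
    apply/asbool_equiv_eq; split => [h1 i|h1 i].
      by have := h1 (lift ord0 i); rewrite tnthS.
    by case: (unliftP ord0 i) => [j ->|->]; rewrite ?tnthS//; exact: h1.
  case: ifPn => _; last by rewrite integral0.
  have mhx : measurable_fun setT (fun y => h (tuple_zip (tuple_cons t x) y)).
    apply: (measurableT_comp mh).
    exact: (measurableT_comp (@measurable_tuple_zip n.+1)
      (measurable_pair1 (tuple_cons t x))).
  rewrite [LHS](integral_tprob_cons (fun i => K (tnth (tuple_cons t x) i))
    (fun y => h0 _) mhx).
  apply: eq_integral => s _; rewrite /k /tuple_kernel.
  under [X in integral (tprob X)]eq_fun do rewrite tnthS.
  by under eq_integral do rewrite tuple_zip_cons.
rewrite (fubini_tonelli (m2 := K t) kD mkD kD0).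
apply: eq_integral => s _; under eq_integral do rewrite kDE.
rewrite -integral_mkcond; apply: (IHn (fun z => h (tuple_cons (t, s) z))) => //.
exact: (measurableT_comp mHc (measurable_pair1 (t, s))).
Qed.

End tuple_kernel.

(** * The completed Lebesgue measure *)

(** The real line with the Lebesgue sigma-algebra, as opposed to the Borel one
    that [R] carries. *)
Definition lebesgue_type (R : realType) : measurableType _ :=
  caratheodory_type ((wlength (@idfun R))^*)%mu.

Definition leb (R : realType) :
    {sigma_finite_measure set (lebesgue_type R) -> \bar R} :=
  @completed_lebesgue_measure R.

Definition toR (R : realType) (x : lebesgue_type R) : R := x.

Section completed_lebesgue.
Context (R : realType).
Local Open Scope ereal_scope.
Notation lam := (@lebesgue_measure R).

Lemma measurable_toR : measurable_fun setT (@toR R).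
Proof. by move=> _ A mA; rewrite setTI; exact: sub_caratheodory. Qed.

Lemma leb_borel (A : set R) : leb R (@toR R @^-1` A) = lam A.
Proof. by []. Qed.

Lemma negligible_lebesgue_type (N : set R) : lam.-negligible N ->
  @measurable _ (lebesgue_type R) N.
Proof.
move=> [B [mB B0 NB]]; apply: negligible_sub_caratheodory.
by exists B; split => //; exact: sub_caratheodory.
Qed.

Lemma lebesgue_borel_union (E : set (lebesgue_type R)) : measurable E ->
  exists2 A : set R, measurable A &
  exists2 N : set R, lam.-negligible N & E = A `|` N.
Proof.
rewrite -[measurable]completed_caratheodory_measurable.
rewrite g_sigma_completed_algebra_genE => -[A mA [N nN <-]].
by exists A => //; exists N.
Qed.

(** Tonelli: the measure of a planar set is the integral of the measures of
    its horizontal sections. *)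
Lemma product_null_sections (M : set (R * R)) : measurable M ->
  (lam \x lam) M = 0 -> {ae lam, forall y, lam (ysection M y) = 0}.
Proof.
move=> mM M0.
have h : \int[lam]_y lam (ysection M y) = 0.
  rewrite -M0 -[RHS]/(\int[lam]_x (lam \o xsection M) x).
  rewrite -[LHS]/(\int[lam]_y (lam \o ysection M) y).
  rewrite -(indic_fubini_tonelli_GE lam mM) -(indic_fubini_tonelli_FE lam mM).
  by rewrite -(indic_fubini_tonelli lam lam mM).
have mf : measurable_fun setT (fun y => lam (ysection M y)).
  exact: measurable_fun_ysection.
have : \int[lam]_y `|lam (ysection M y)| = 0.
  by under eq_integral do rewrite gee0_abs//.
move/(ae_eq_integral_abs lam measurableT mf).
by apply: filterS => y; exact.
Qed.

(** The sets with this property form a sigma-algebra; it contains the Borel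
    sets, all of whose sections are Borel, and the null sets, almost all of
    whose sections are null, hence measurable for the completed measure. *)
Lemma plane_sections (E : set (R * R)) :
  @measurable _ (lebesgue_plane R) E ->
  {ae lam, forall y, @measurable _ (lebesgue_type R) (ysection E y)}.
Proof.
have aeF : Filter (nbhs (almost_everywhere lam)).
  exact: ae_filter_ringOfSetsType.
move: E; apply: smallest_sub; first split.
- by apply: aeW => y; rewrite ysection0; exact: measurable0.
- move=> E /=; apply: filterS => y mEy.
  have -> : ysection ([set: R * R] `\` E) y = ~` ysection E y.
    by rewrite setTD; apply/seteqP; split => x /=; rewrite /ysection/= !inE.
  exact: measurableC.
- move=> F mF /=; have := ae_foralln mF.
  by apply: filterS => y mFy; rewrite ysection_bigcup; exact: bigcupT_measurable.
move=> _ [A mA [N [M [mM M0 NM]] <-]].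
apply: filterS (product_null_sections mM M0) => y My0.
have -> : ysection (A `|` N) y = ysection A y `|` ysection N y.
  by apply/seteqP; split => x; rewrite /ysection/= !inE.
apply: measurableU; first exact: sub_caratheodory (measurable_ysection y mA).
apply: negligible_lebesgue_type; exists (ysection M y); split => //.
  exact: measurable_ysection.
by move=> x; rewrite /ysection/= !inE; exact: NM.
Qed.

End completed_lebesgue.

Section limit_permutation_sections.
Context (R : realType) (Z : R -> R -> R).
Hypothesis hZ : limit_permutation Z.
Notation lam := (@lebesgue_measure R).

Definition unitT : set (lebesgue_type R) := [set x | 0 <= toR x <= 1].

Lemma measurable_unitT : measurable unitT.
Proof.
rewrite (_ : unitT = @toR R @^-1` `[0, 1]).
  by rewrite -[X in measurable X]setTI; exact: measurable_toR.
by apply/seteqP; split => x /=; rewrite in_itv.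
Qed.

(** An interval has positive measure, so it is not contained in a null set. *)
Lemma dense_of_ae (P : R -> Prop) (a b : R) : a < b ->
  {ae lam, forall y, P y} -> exists2 y, a < y < b & P y.
Proof.
move=> ab [N [mN N0 PN]]; apply: contrapT => nP.
suff : (lam `]a, b[ <= lam N)%E.
  by rewrite lebesgue_measure_itv/= lte_fin ab N0 -EFinB lee_fin leNgt subr_gt0 ab.
apply: le_measure; rewrite ?inE//.
move=> y /=; rewrite in_itv/= => aby; apply: PN => Py; apply: nP.
by exists y.
Qed.

(** Countably many level sets of [Z] suffice, and each of them has measurable
    sections at almost every ordinate. *)
Lemma ae_measurable_sections :
  {ae lam, forall y, 0 <= y <= 1 ->
     measurable_fun unitT (fun x : lebesgue_type R => Z (toR x) y)}.
Proof.
have aeF : Filter (nbhs (almost_everywhere lam)).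
  exact: ae_filter_ringOfSetsType.
pose sq : set (R * R) := unit_itv R `*` unit_itv R.
have msq : @measurable _ (lebesgue_plane R) sq.
  apply: sub_sigma_algebra; exists sq.
    by apply: measurableX; exact: measurable_itv.
  by exists set0; [exact: negligible_set0|rewrite setU0].
pose E (q : R) : set (R * R) := sq `&` [set p | Z p.1 p.2 < q].
have mE q : @measurable _ (lebesgue_plane R) (E q).
  rewrite (_ : E q = sq `&` (fun p => Z p.1 p.2) @^-1` `]-oo, q[).
    exact: (limperm_measurable hZ).
  by apply/seteqP; split => p /=; rewrite in_itv.
(* an enumeration of the rationals *)
pose q_ n : R := ratr (odflt 0 (unpickle n)).
have := ae_foralln (fun n => plane_sections (mE (q_ n))).
apply: filterS => y my y01.
apply: (measurability _ (RGenInftyO.measurableE R)) => _ [_ [c ->] <-].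
rewrite (_ : _ `&` _ = \bigcup_(n in [set n | q_ n <= c]) ysection (E (q_ n)) y).
  by apply: bigcup_measurable => n _; exact: my.
apply/seteqP; split => x /=; rewrite in_itv/=.
  move=> [x01 /rat_in_itvoo[q]]; rewrite in_itv/= => /andP[Zq qc].
  exists (pickle q); rewrite /ysection/= /q_ pickleK/= ?(ltW qc)// inE.
  by split=> //; split; rewrite /= /unit_itv/= in_itv.
move=> [n /= qc]; rewrite /ysection/= inE => -[[/=]].
rewrite /unit_itv/= !in_itv/= => x01 _ Zq; split => //.
exact: lt_le_trans qc.
Qed.

(** Ordinates with a measurable section are dense, so every [y > 0] is the
    limit from the left of a sequence of them; left continuity makes [Z(., y)]
    the pointwise limit of the corresponding sections. *)
Lemma measurable_sections y : 0 <= y <= 1 ->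
  measurable_fun unitT (fun x : lebesgue_type R => Z (toR x) y).
Proof.
move=> /andP[y0 y1]; have [<-|yN0] := eqVneq 0 y.
  move=> mU B mB.
  rewrite (_ : _ `&` _ = unitT `&` (cst 0 @^-1` B)).
    exact: (measurable_cst _ mU).
  apply/seteqP; split => x /= [x01]; rewrite (cdf_at0 (limperm_cdf hZ x01))//.
have y_gt0 : 0 < y by rewrite lt_neqAle yN0.
have H n : exists z : R, [/\ 0 < z < y, y - n.+1%:R^-1 < z &
    measurable_fun unitT (fun x : lebesgue_type R => Z (toR x) z)].
  have /dense_of_ae/(_ ae_measurable_sections)[z] :
      Num.max 0 (y - n.+1%:R^-1) < y.
    by rewrite gt_max y_gt0/= ltrBlDr ltrDl invr_gt0.
  rewrite gt_max => /andP[/andP[z0 zn] zy] mz; exists z; split => //.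
    by rewrite z0.
  by apply: mz; rewrite ltW//= (le_trans (ltW zy)).
pose z n := projT1 (cid (H n)).
have zP n : [/\ 0 < z n < y, y - n.+1%:R^-1 < z n &
    measurable_fun unitT (fun x : lebesgue_type R => Z (toR x) (z n))].
  exact: (projT2 (cid (H n))).
apply: (@measurable_fun_cvg _ _ _ _ (fun n x => Z (toR x) (z n))).
  by move=> n; case: (zP n).
move=> x x01; have := cdf_left_cont (limperm_cdf hZ x01).
move=> /(_ y); rewrite y_gt0 y1 => /(_ isT)/cvg_at_leftP; apply; split.
  by move=> n; case: (zP n) => /andP[].
apply: (@squeeze_cvgr _ _ _ _ (fun n => y - n.+1%:R^-1) (fun=> y)).
- by apply: nearW => n; case: (zP n) => /andP[_ /ltW -> /ltW ->].
- rewrite -[X in _ --> X](subr0 y); apply: cvgB; first exact: cvg_cst.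
  exact: cvg_harmonic.
- exact: cvg_cst.
Qed.

End limit_permutation_sections.
Arguments unitT R : clear implicits.

(** * The joint law of a limit permutation *)

Section restricted_probability.
Context d (T : measurableType d) (R : realType).
Variables (la : {sigma_finite_measure set T -> \bar R}) (D : set T).
Hypotheses (mD : measurable D) (laD : la D = 1%E).
Local Open Scope ereal_scope.

Let restr1 : mrestr la mD setT = 1.
Proof. by rewrite /mrestr setTI. Qed.

Definition restr_prob : probability T R :=
  HB.pack (Measure.sort (mrestr la mD)) (Measure.class (mrestr la mD))
    (Measure_isProbability.Build _ _ _ _ restr1).

Lemma integral_restr_prob (f : T -> \bar R) : (forall x, 0 <= f x) ->
  measurable_fun setT f -> \int[restr_prob]_x f x = \int[la]_(x in D) f x.
Proof.
move=> f0 mf; rewrite -[in LHS](setUv D) ge0_integral_setU//=; last 3 first.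
- exact: measurableC.
- by rewrite setUv.
- by rewrite disj_set2E setICr.
rewrite [X in _ + X](_ : _ = 0) ?adde0.
  apply: eq_measure_integral => A mA AD.
  by rewrite /= /mrestr setIidl.
rewrite -[RHS](integral_measure_zero (~` D) f).
apply: eq_measure_integral => A mA AD.
rewrite /= /mrestr (_ : A `&` D = set0) ?measure0//.
by apply/seteqP; split => // x [/AD].
Qed.

End restricted_probability.

Section cdf_measure_below.
Context (R : realType) (F : R -> R).
Hypothesis hF : is_cdf F.
Local Open Scope ereal_scope.
Notation mu := (cdf_measure F).

Lemma cdf_measure01 : mu `[0%R, 1%R]%classic = 1.
Proof. exact: (cdf_measureP hF).1. Qed.

Lemma cdf_measure_outside : mu (~` `[0%R, 1%R]%classic) = 0.
Proof. by rewrite probability_setC// cdf_measure01 subee. Qed.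

Lemma cdf_measure_setI01 (A : set R) : measurable A ->
  mu A = mu (A `&` `[0%R, 1%R]%classic).
Proof.
move=> mA; rewrite -[in LHS](setUIDK A `[0%R, 1%R]%classic) measureU0//.
- exact: measurableI.
- exact: measurableD.
- apply/eqP; rewrite eq_le measure_ge0 andbT -cdf_measure_outside.
  apply: le_measure => [||x []//]; rewrite inE; first exact: measurableD.
  exact: measurableC.
Qed.

(** The measure of a cdf lives on [0, 1], where it is prescribed on the
    intervals [[0, c[]. *)
Lemma cdf_measure_below (c : R) : mu `]-oo, c[%classic =
  (if c <= 0 then 0 else if c <= 1 then F c else 1)%R%:E.
Proof.
rewrite cdf_measure_setI01//; case: ifPn => [c0|].
  rewrite (_ : _ `&` _ = set0) ?measure0//; apply/seteqP; split => // x [].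
  rewrite /= !in_itv/= => xc /andP[x0 _].
  by move: (lt_le_trans xc c0); rewrite ltNge x0.
rewrite -ltNge => c0; case: ifPn => [c1|].
  rewrite (_ : _ `&` _ = `[0%R, c[%classic).
    by rewrite (cdf_measureP hF).2// (cdf_at0 hF) subr0.
  apply/seteqP; split => x /=; rewrite !in_itv/=; first by move=> [-> /andP[->]].
  by move=> /andP[-> xc]; rewrite xc (le_trans (ltW xc)).
rewrite -ltNge => c1; rewrite (_ : _ `&` _ = `[0%R, 1%R]%classic).
  exact: cdf_measure01.
apply/seteqP; split => x /=; rewrite !in_itv/=; first by move=> [].
by move=> /andP[-> x1]; rewrite x1 (le_lt_trans x1).
Qed.

End cdf_measure_below.

Section limit_permutation_law.
Context (R : realType) (Z : R -> R -> R).
Hypothesis hZ : limit_permutation Z.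
Local Open Scope ereal_scope.

Lemma leb_unitT : leb R (unitT R) = 1.
Proof.
rewrite (_ : unitT R = @toR R @^-1` `[0%R, 1%R]).
  rewrite leb_borel lebesgue_measure_itv/= lte_fin ltr01.
  by rewrite -EFinB subr0.
by apply/seteqP; split => x /=; rewrite in_itv.
Qed.

Definition uniform01 : probability (lebesgue_type R) R :=
  restr_prob (@measurable_unitT R) leb_unitT.

(** Outside [0, 1] the measure is arbitrary, but it must depend measurably on
    [x]. *)
Definition limit_kernel (x : lebesgue_type R) : pprobability (measurableTypeR R) R :=
  if (0 <= toR x <= 1)%R then cdf_measure (Z (toR x))
  else dirac (0%R : measurableTypeR R).

Lemma limit_kernel_unit (x : lebesgue_type R) : unitT R x ->
  limit_kernel x = cdf_measure (Z (toR x)).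
Proof. by rewrite /limit_kernel => ->. Qed.

Lemma measurable_limit_kernel : measurable_fun setT limit_kernel.
Proof.
apply: (measurable_kernel_generated (RGenInftyO.measurableE R)).
  move=> _ _ [a ->] [b ->]; exists (Num.min a b).
  apply/seteqP; split => x /=; rewrite !in_itv/= lt_min; first by move=> [-> ->].
  by move=> /andP[].
move=> _ [c ->].
have mdom : measurable_fun setT (fun x : lebesgue_type R => (0 <= toR x <= 1)%R).
  apply: measurable_and.
    apply: (@measurable_fun_ler _ (lebesgue_type R) R setT (fun=> 0%R) (@toR R)).
      exact: measurable_cst.
    exact: measurable_toR.
  apply: (@measurable_fun_ler _ (lebesgue_type R) R setT (@toR R) (fun=> 1%R)).
    exact: measurable_toR.
  exact: measurable_cst.
pose g (x : lebesgue_type R) : R :=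
  (if c <= 0 then 0 else if c <= 1 then Z (toR x) c else 1)%R.
have mg : measurable_fun (unitT R) g.
  rewrite /g; case: (boolP (c <= 0)%R) => c0; first exact: measurable_cst.
  case: (boolP (c <= 1)%R) => c1; last exact: measurable_cst.
  by apply: (measurable_sections hZ); rewrite c1 ltW// ltNge.
rewrite (_ : (fun x => _) = (fun x : lebesgue_type R => if (0 <= toR x <= 1)%R
   then (g x)%:E else \d_(0%R : measurableTypeR R) `]-oo, c[%classic)).
  apply: (measurable_fun_if measurableT mdom); last exact: measurable_cst.
  by apply/measurable_EFinP; rewrite setTI; exact: mg.
apply/funext => x; rewrite /limit_kernel; case: ifPn => // x01.
by rewrite cdf_measure_below//; exact: (limperm_cdf hZ).
Qed.

Definition permuton : probability (lebesgue_type R * measurableTypeR R)%type R :=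
  joint_law uniform01 measurable_limit_kernel.

Definition fstR (p : lebesgue_type R * measurableTypeR R) : R := toR p.1.
Definition sndR (p : lebesgue_type R * measurableTypeR R) : R := p.2.

Lemma measurable_fstR : measurable_fun setT fstR.
Proof. exact: (measurableT_comp (@measurable_toR R) measurable_fst). Qed.

Lemma measurable_sndR : measurable_fun setT sndR.
Proof. exact: measurable_snd. Qed.

Lemma integral_permuton_square (f : lebesgue_type R * measurableTypeR R -> \bar R) :
  (forall p, 0 <= f p) -> measurable_fun setT f ->
  \int[permuton]_(p in square fstR sndR) f p =
  \int[leb R]_(x in unitT R)
    \int[cdf_measure (Z (toR x))]_(y in `[0%R, 1%R]%classic) f (x, y).
Proof.
move=> f0 mf.
have msq := measurable_square measurable_fstR measurable_sndR.
pose fsq := f \_ (square fstR sndR).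
have fsq0 p : 0 <= fsq p by apply: erestrict_ge0 => q _; exact: f0.
have mfsq : measurable_fun setT fsq.
  by apply/(measurable_restrictT _ msq); exact: measurable_funTS.
rewrite integral_mkcond -[LHS]/(\int[permuton]_p fsq p).
rewrite [LHS](integral_joint_law uniform01 measurable_limit_kernel fsq0 mfsq).
rewrite integral_restr_prob; last 2 first.
- by move=> x; apply: integral_ge0 => y _; exact: fsq0.
- exact: (measurable_integral_kernel measurable_limit_kernel fsq0 mfsq).
apply: eq_integral => x /set_mem x01; rewrite limit_kernel_unit//.
rewrite [RHS]integral_mkcond; apply: eq_integral => y _.
rewrite /fsq !patchE; congr (if _ then _ else _); apply/asbool_equiv_eq.
by rewrite /square/= in_itv/=; split => [[]|].
Qed.

Lemma permuton_square (A : set (lebesgue_type R * measurableTypeR R)) :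
  measurable A ->
  permuton (square fstR sndR `&` A) =
  \int[leb R]_(x in unitT R)
    cdf_measure (Z (toR x)) (`[0%R, 1%R]%classic `&` xsection A x).
Proof.
move=> mA; have msq := measurable_square measurable_fstR measurable_sndR.
rewrite setIC -integral_indic// integral_permuton_square; last 2 first.
- by move=> p; rewrite lee_fin.
- exact/measurable_EFinP.
apply: eq_integral => x _.
have mAx : measurable (xsection A x) by exact: measurable_xsection.
rewrite setIC -integral_indic//; apply: eq_integral => y _.
congr (_%:E); rewrite !indicE; congr (nat_of_bool _)%:R.
by rewrite mem_xsection.
Qed.

Lemma permuton_uniform_fst : uniform_coord fstR sndR permuton fstR.
Proof.
move=> c /andP[c0 c1].
rewrite permuton_square; last exact: (measurable_below _ measurable_fstR).
have mc : measurable [set x : lebesgue_type R | (toR x < c)%R].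
  exact: (measurable_below _ (@measurable_toR R)).
transitivity (\int[leb R]_(x in unitT R) (\1_[set x | (toR x < c)%R] x)%:E).
  apply: eq_integral => x /set_mem x01; rewrite indicE.
  have [/set_mem xc|/negP xc] := boolP (x \in _).
    rewrite (_ : xsection _ x = setT) ?setIT.
      exact: (cdf_measure01 (limperm_cdf hZ x01)).
    by apply/seteqP; split => // y _; rewrite /xsection/= inE.
  rewrite (_ : xsection _ x = set0) ?setI0 ?measure0//.
  apply/seteqP; split => // y; rewrite /xsection/= inE => xc'; apply: xc.
rewrite integral_indic//; last exact: measurable_unitT.
rewrite (_ : _ `&` _ = @toR R @^-1` `[0%R, c[); last first.
  apply/seteqP; split => x /=; rewrite in_itv/=.
    by move=> [xc /andP[-> _]].
  by move=> /andP[x0 xc]; split => //; rewrite /unitT/= x0 (ltW (lt_le_trans xc c1)).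
rewrite -[LHS]/(@lebesgue_measure R `[0%R, c[%classic).
rewrite lebesgue_measure_itv/= lte_fin.
move: c0; rewrite le_eqVlt => /orP[/eqP <-|c0]; rewrite ?ltxx//.
by rewrite c0 -EFinB subr0.
Qed.

(** This is the condition that the integral of [Z(., y)] is [y]. *)
Lemma permuton_uniform_snd : uniform_coord fstR sndR permuton sndR.
Proof.
move=> c c01; have /andP[c0 c1] := c01.
rewrite permuton_square; last exact: (measurable_below _ measurable_sndR).
rewrite -(limperm_integral hZ c01).
apply: eq_integral => x /set_mem x01.
have hF := limperm_cdf hZ x01.
have -> : xsection [set p | (sndR p < c)%R] x = `]-oo, c[%classic.
  by apply/seteqP; split => y; rewrite /xsection/= inE in_itv.
rewrite setIC -cdf_measure_setI01// cdf_measure_below//.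
case: ifPn => [c0'|]; last by rewrite c1.
by have -> : c = 0%R by [apply/eqP; rewrite eq_le c0']; rewrite (cdf_at0 hF).
Qed.

End limit_permutation_law.

(** * Densities as pattern probabilities *)

Section density_formula.
Context (R : realType) (Z : R -> R -> R).
Hypothesis hZ : limit_permutation Z.
Local Open Scope ereal_scope.
Notation K := (@limit_kernel R Z).

Lemma measurable_simplex (m : nat) :
  @measurable _ (m.-tuple (measurableTypeR R)) (@simplex R m).
Proof.
rewrite (_ : @simplex R m = @box _ (measurableTypeR R) _
      (fun=> [set x : R | (0 <= x <= 1)%R]) `&`
    [set x : m.-tuple R | increasing (fun i => tnth x i)])//.
apply: measurableI.
  apply: measurable_box => _.
  exact: (measurable_between (T := measurableTypeR R) (@measurable_id _ _ _)).
apply: (@measurable_increasing _ (measurableTypeR R) R m id (fun i => i)).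
exact: measurable_id.
Qed.

(** Reindexing moves the permutation from the measures to the variables: the
    ordinates, taken in the order of the permutation, have to increase. *)
Lemma simplex_kernel (m : nat) (s : 'S_m) (x : m.-tuple (lebesgue_type R)) :
  box (fun=> unitT R) x ->
  \int[tuple_measure (fun i : 'I_m => cdf_measure (Z (tnth x (s i))))]_(
     y in (@simplex R m : set _)) 1 =
  tuple_kernel K x (reindex_tuple s @^-1` (@simplex R m)).
Proof.
move=> x01.
rewrite (_ : (fun i : 'I_m => cdf_measure (Z (tnth x (s i))) : set _ -> _) =
   (fun i => K (tnth x (s i)) : set _ -> _)); last first.
  by apply/funext => i; rewrite limit_kernel_unit//; exact: x01.
rewrite (tprobE (fun i => K (tnth x (s i)))).
rewrite integral_cst; last exact: measurable_simplex.
rewrite mul1e.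
exact: (tprob_perm (fun i => K (tnth x i)) s (@measurable_simplex m)).
Qed.

(** The density is the probability that [m] independent points of the permuton
    have increasing abscissas and relative order [tau], multiplied by the
    number [m!] of orders in which the abscissas can come. *)
Lemma limit_densityE (m : nat) (tau : 'S_m) : limit_density tau Z =
  (m`!%:R * fine (tprob (fun _ : 'I_m => permuton hZ)
     (sorted_by (@fstR R) (@sndR R) 1%g (tau^-1)%g)))%R.
Proof.
rewrite /limit_density; congr (_ * fine _)%R.
rewrite -[LHS]/(\int[tuple_measure (fun _ : 'I_m => leb R)]_(
        x in (@simplex R m : set (m.-tuple (lebesgue_type R))))
       \int[tuple_measure (fun i : 'I_m => cdf_measure (Z (tnth x ((tau^-1)%g i))))]_(
          y in (@simplex R m : set _)) 1)%E.
rewrite (tuple_sfmE (fun _ : 'I_m => leb R)).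
set S := sorted_by _ _ _ _.
have mS : measurable S.
  by apply: measurable_sorted_by; [exact: measurable_fstR|exact: measurable_sndR].
transitivity (\int[tuple_sfm (fun _ : 'I_m => leb R)]_(x in box (fun=> unitT R))
   \int[tuple_kernel K x]_y (\1_S (tuple_zip x y))%:E); last first.
  rewrite (@integral_tuple_kernel _ _ _ _ _ K (measurable_limit_kernel hZ)
    (leb R) (unitT R) (uniform01 R) (@measurable_unitT R) _ m (fun z => (\1_S z)%:E)).
  - by rewrite integral_indic// setIT.
  - by move=> f f0 mf; exact: integral_restr_prob.
  - by move=> z; rewrite lee_fin.
  - exact/measurable_EFinP.
rewrite [LHS]integral_mkcond [RHS]integral_mkcond.
apply: eq_integral => x _; rewrite !patchE.
have mSx : measurable [set y : m.-tuple (measurableTypeR R) | S (tuple_zip x y)].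
  have mz : measurable_fun setT (fun y : m.-tuple (measurableTypeR R) => tuple_zip x y).
    exact: (measurableT_comp (@measurable_tuple_zip _ _ _ _ m) (measurable_pair1 x)).
  by have := mz measurableT _ mS; rewrite setTI.
have [/set_mem x01|/negP nx01] := boolP (x \in box _); last first.
  rewrite ifF//; apply/negP => /set_mem[x01 _]; apply: nx01; exact/mem_set.
transitivity (tuple_kernel K x [set y | S (tuple_zip x y)]); last first.
  by rewrite -[in LHS](setIT [set y | _]) -integral_indic.
case: ifPn => [/set_mem[_ xinc]|/negP nx].
  rewrite simplex_kernel//; congr (tuple_kernel K x _).
  apply/seteqP; split => y /= [y01 yinc].
    split => [i|]; last split => i j ij.
    - rewrite tnth_mktuple; split; first exact: x01.
      by have := y01 (tau i); rewrite tnth_mktuple permK.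
    - by rewrite !tnth_mktuple /fstR /= !perm1; exact: xinc.
    - by have := yinc _ _ ij; rewrite !tnth_mktuple.
  have [_ yinc'] := yinc; split => [i|i j ij]; rewrite !tnth_mktuple.
    by have := y01 ((tau^-1)%g i); rewrite tnth_mktuple => -[].
  by have := yinc' _ _ ij; rewrite !tnth_mktuple.
rewrite (_ : [set y | _] = set0) ?measure0//.
apply/seteqP; split => // y [_ [xinc _]]; apply: nx; apply/mem_set; split.
  exact: x01.
by move=> i j ij; have := xinc _ _ ij; rewrite !tnth_mktuple /fstR /= !perm1.
Qed.

End density_formula.

(** * Uniqueness of limit permutations *)

Section integrals_determine.
Context (R : realType) (g1 g2 : lebesgue_type R -> R).
Hypotheses (mg1 : measurable_fun (unitT R) g1).
Hypotheses (mg2 : measurable_fun (unitT R) g2).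
Hypothesis g101 : forall x, unitT R x -> 0 <= g1 x <= 1.
Hypothesis g201 : forall x, unitT R x -> 0 <= g2 x <= 1.
Hypothesis g12 : forall c : R,
  (\int[uniform01 R]_(x in unitT R `&` [set x | (toR x < c)%R]) (g1 x)%:E =
   \int[uniform01 R]_(x in unitT R `&` [set x | (toR x < c)%R]) (g2 x)%:E)%E.
Local Open Scope ereal_scope.
Let I (g : lebesgue_type R -> R) (A : set (lebesgue_type R)) :=
  \int[uniform01 R]_(x in unitT R `&` A) (g x)%:E.
Let ok (g : lebesgue_type R -> R) :=
  measurable_fun (unitT R) g /\ forall x, unitT R x -> (0 <= g x <= 1)%R.

Let I_fin g A : ok g -> measurable A -> I g A \is a fin_num.
Proof.
move=> [mg g01] mA; have mUA := measurableI _ _ (@measurable_unitT R) mA.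
apply: integrable_fin_num => //.
apply: measurable_bounded_integrable => //.
- by apply: le_lt_trans (ltry 1); exact: probability_le1.
- by apply: measurable_funS mg => //; exact: measurable_unitT.
- exists 1%R; split => // M M1 t [Dt _] /=; rewrite (le_trans _ (ltW M1))//.
  by have /andP[g0 g1'] := g01 _ Dt; rewrite ger0_norm.
Qed.

Let I_setC g A : ok g -> measurable A -> I g setT = I g A + I g (~` A).
Proof.
move=> [mg g01] mA; rewrite /I -(setUv A) setIUr ge0_integral_setU//.
- by apply: measurableI => //; exact: measurable_unitT.
- by apply: measurableI; [exact: measurable_unitT|exact: measurableC].
- rewrite -setIUr setUv setIT; exact/measurable_EFinP.
- by rewrite -setIUr => x [/g01/andP[]].
- by rewrite disj_set2E setIACA setICr setI0.
Qed.

(** Both indefinite integrals are finite measures that agree on the pi-system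
    of rays. *)
Lemma integrals_borel (A : set R) : measurable A ->
  I g1 (@toR R @^-1` A) = I g2 (@toR R @^-1` A).
Proof.
have ok1 : ok g1 by []. have ok2 : ok g2 by [].
have mpre (B : set R) : measurable B -> measurable (@toR R @^-1` B).
  by move=> mB; rewrite -[X in measurable X]setTI; exact: measurable_toR.
have IT : I g1 setT = I g2 setT.
  have := g12 2%R; rewrite (_ : _ `&` _ = unitT R `&` setT)//.
  apply/seteqP; split => x [x01 _]; split => //=.
  by move: x01 => /andP[_ x1]; rewrite (le_lt_trans x1)// ltr1n.
have GE : @measurable _ (measurableTypeR R) = <<s @RGenInftyO.G R >>.
  exact: RGenInftyO.measurableE.
move=> mA; have {mA} : <<s @RGenInftyO.G R >> A by rewrite -GE.
move: A.
apply: (@dynkin_induction _ (measurableTypeR R) _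
  (fun A => I g1 (@toR R @^-1` A) = I g2 (@toR R @^-1` A))).
- exact: GE.
- move=> _ _ [a ->] [b ->]; exists (Num.min a b).
  apply/seteqP; split => x /=; rewrite !in_itv/= lt_min; first by move=> [-> ->].
  by move=> /andP[].
- by [].
- move=> _ [c ->]; have := g12 c.
  by rewrite (_ : [set x | _] = @toR R @^-1` `]-oo, c[).
- move=> A mA IA; have := IT.
  rewrite (I_setC ok1 (mpre _ mA)) (I_setC ok2 (mpre _ mA)) IA.
  have fin := I_fin ok2 (mpre _ mA).
  move=> e; rewrite -[LHS](addeK _ fin) -[RHS](addeK _ fin).
  congr (_ - _); apply: etrans (addeC _ _) _; apply: etrans e _.
  exact: addeC.
- move=> F mF tF IF; rewrite preimage_bigcup /I setI_bigcupr.
  have mUF k : measurable (unitT R `&` @toR R @^-1` F k).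
    by apply: measurableI; [exact: measurable_unitT|exact: (mpre _ (mF k))].
  have tUF : trivIset setT (fun k => unitT R `&` @toR R @^-1` F k).
    move=> i j _ _ [x [[_ Fi] [_ Fj]]]; apply: (tF i j) => //.
    by exists (toR x).
  have sub : \bigcup_k (unitT R `&` @toR R @^-1` F k) `<=` unitT R.
    by move=> x [k _ []].
  rewrite !ge0_integral_bigcup//.
  + by apply: eq_eseriesr => k _; exact: IF.
  + by apply/measurable_EFinP; apply: measurable_funS mg2 => //; exact: measurable_unitT.
  + by move=> x /sub/g201/andP[].
  + by apply/measurable_EFinP; apply: measurable_funS mg1 => //; exact: measurable_unitT.
  + by move=> x /sub/g101/andP[].
Qed.

Lemma uniform01_negligible (N : set (lebesgue_type R)) : measurable N ->
  (@lebesgue_measure R).-negligible N -> uniform01 R N = 0.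
Proof.
move=> mN [B [mB B0 NB]]; apply/eqP; rewrite eq_le measure_ge0 andbT -B0.
rewrite -[leRHS]/(leb R (@toR R @^-1` B)) -[leLHS]/(leb R (N `&` unitT R)).
apply: le_measure; rewrite ?inE; last by move=> x [/NB].
- by apply: measurableI => //; exact: measurable_unitT.
- by rewrite -[X in measurable X]setTI; exact: measurable_toR.
Qed.

(** Equality of the integrals over Borel sets extends to Lebesgue measurable
    sets, which are Borel up to a null set, and therefore forces equality
    almost everywhere. *)
Lemma integrals_determine_ae :
  {ae uniform01 R, forall x, unitT R x -> g1 x = g2 x}.
Proof.
have ok1 : ok g1 by []. have ok2 : ok g2 by [].
have mU := @measurable_unitT R.
have h g (E : set (lebesgue_type R)) (A : set R) : ok g -> E `<=` unitT R ->
    measurable E -> measurable A -> toR (R:=R) @^-1` A `<=` E ->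
    lebesgue_measure.-negligible (E `\` A) ->
    \int[uniform01 R]_(x in E) (g x)%:E = I g (@toR R @^-1` A).
  move=> [mg g01] EU mE mA AE nEA.
  have mA' : measurable (@toR R @^-1` A).
    by rewrite -[X in measurable X]setTI; exact: measurable_toR.
  have mEA : measurable (E `\` @toR R @^-1` A) by exact: measurableD.
  rewrite /I (setIidr (subset_trans AE EU)) -[in LHS](setDUK AE).
  rewrite ge0_integral_setU//; last 3 first.
  - by rewrite setDUK//; apply/measurable_EFinP; exact: measurable_funS mg.
  - by rewrite setDUK// => x /EU/g01/andP[].
  - by rewrite disj_set2E setDIK.
  rewrite [X in _ + X](_ : _ = 0) ?adde0//; apply: null_set_integral => //.
    apply/measurable_EFinP; apply: measurable_funS mg => //.
    by move=> x [/EU].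
  exact: uniform01_negligible.
have intU (E : set (lebesgue_type R)) : E `<=` unitT R -> measurable E ->
    \int[uniform01 R]_(x in E) (g1 x)%:E = \int[uniform01 R]_(x in E) (g2 x)%:E.
  move=> EU mE; have [A mA [N nN EAN]] := lebesgue_borel_union mE.
  have AE : toR (R:=R) @^-1` A `<=` E by rewrite EAN; exact: subsetUl.
  have nEA : (@lebesgue_measure R).-negligible (E `\` A).
    by apply: negligibleS nN => x; rewrite EAN => -[[]].
  by rewrite (h g1 E A)// (h g2 E A)// integrals_borel.
have ig1 : (uniform01 R).-integrable (unitT R) (fun x => (g1 x)%:E).
  apply: measurable_bounded_integrable => //.
    by apply: le_lt_trans (ltry 1); exact: probability_le1.
  exists 1%R; split => // M M1 t Dt /=; rewrite (le_trans _ (ltW M1))//.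
  by have /andP[g0 g1'] := g101 Dt; rewrite ger0_norm.
have := integral_ae_eq mU ig1 _ intU.
have mg2' : measurable_fun (unitT R) (fun x => (g2 x)%:E).
  exact/measurable_EFinP.
have aeF : Filter (nbhs (almost_everywhere (uniform01 R))).
  exact: ae_filter_ringOfSetsType.
by move=> /(_ mg2'); apply: filterS => x e Ux; have [] := e Ux.
Qed.

End integrals_determine.

Section kernel_moments.
Context (R : realType) (Z : R -> R -> R).
Hypothesis hZ : limit_permutation Z.
Local Open Scope ereal_scope.

Definition kernel_moment (b : nat) (x : lebesgue_type R) : R :=
  fine (\int[cdf_measure (Z (toR x))]_(y in `[0%R, 1%R]%classic) (y ^+ b)%:E).

Lemma kernel_moment_integral (b : nat) (x : lebesgue_type R) : unitT R x ->
  0 <= \int[cdf_measure (Z (toR x))]_(y in `[0%R, 1%R]%classic) (y ^+ b)%:E <= 1.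
Proof.
move=> x01; have hF := limperm_cdf hZ x01; apply/andP; split.
  apply: integral_ge0 => y /=; rewrite in_itv/= => /andP[y0 _].
  by rewrite lee_fin exprn_ge0.
rewrite -(cdf_measure01 hF) -[leRHS]mul1e -integral_cst//.
apply: ge0_le_integral => //.
- by move=> y /=; rewrite in_itv/= => /andP[y0 _]; rewrite lee_fin exprn_ge0.
- by apply/measurable_EFinP; exact: measurable_funX.
- by move=> y /=; rewrite in_itv/= => /andP[y0 y1]; rewrite lee_fin exprn_ile1.
Qed.

Lemma kernel_momentK (b : nat) (x : lebesgue_type R) : unitT R x ->
  (kernel_moment b x)%:E =
  \int[cdf_measure (Z (toR x))]_(y in `[0%R, 1%R]%classic) (y ^+ b)%:E.
Proof.
move=> /(kernel_moment_integral b)/andP[i0 i1]; rewrite /kernel_moment fineK//.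
by rewrite ge0_fin_numE// (le_lt_trans i1)// ltry.
Qed.

Lemma kernel_moment01 (b : nat) (x : lebesgue_type R) : unitT R x ->
  (0 <= kernel_moment b x <= 1)%R.
Proof.
move=> x01; have := kernel_moment_integral b x01.
by rewrite -kernel_momentK// !lee_fin.
Qed.

Lemma measurable_kernel_moment (b : nat) :
  measurable_fun (unitT R) (kernel_moment b).
Proof.
pose f (p : lebesgue_type R * measurableTypeR R) : \bar R :=
  ((fun y : R => (y ^+ b)%:E) \_ `[0%R, 1%R]%classic) p.2.
have f0 p : 0 <= f p.
  apply: erestrict_ge0 => y /=; rewrite in_itv/= => /andP[y0 _].
  by rewrite lee_fin exprn_ge0.
have mf : measurable_fun setT f.
  apply: (@measurableT_comp _ _ _ _ _ _
    ((fun y : R => (y ^+ b)%:E) \_ `[0%R, 1%R]%classic)); last exact: measurable_snd.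
  apply/(measurable_restrictT _ (measurable_itv _)).
  by apply/measurable_EFinP; exact: measurable_funX.
have mF := measurable_integral_kernel (measurable_limit_kernel hZ) f0 mf.
apply: (@eq_measurable_fun _ _ _ _ _
  (fun x => fine (\int[limit_kernel Z x]_y f (x, y)))).
  move=> x /set_mem x01; rewrite /kernel_moment limit_kernel_unit//.
  by rewrite [in RHS]integral_mkcond.
apply: measurable_funTS.
exact: (measurableT_comp (@fine_measurable R setT measurableT) mF).
Qed.

Lemma integral_uniform01 (f : lebesgue_type R -> \bar R) :
  \int[uniform01 R]_(x in unitT R) f x = \int[leb R]_(x in unitT R) f x.
Proof.
apply: eq_measure_integral => A mA AU.
by rewrite -[LHS]/(leb R (A `&` unitT R)) setIidl.
Qed.

(** Integrating first in the ordinate turns a mixed moment of the permuton into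
    a moment of the abscissa, weighted by a moment of the kernel. *)
Lemma permuton_moment (a b : nat) :
  \int[permuton hZ]_(p in square (@fstR R) (@sndR R))
    (fstR p ^+ a * sndR p ^+ b)%:E =
  \int[uniform01 R]_(x in unitT R) (toR x ^+ a * kernel_moment b x)%:E.
Proof.
transitivity (\int[permuton hZ]_(p in square (@fstR R) (@sndR R))
    (`|fstR p| ^+ a * `|sndR p| ^+ b)%:E).
  (* absolute values make the integrand nonnegative outside the square too *)
  apply: eq_integral => p /set_mem[/andP[u0 _] /andP[v0 _]].
  by rewrite !ger0_norm.
rewrite integral_permuton_square; last 2 first.
- by move=> p; rewrite lee_fin mulr_ge0// exprn_ge0.
- apply/measurable_EFinP; apply: measurable_funM; apply: measurable_funX.
    apply: measurableT_comp; [exact: normr_measurable|exact: measurable_fstR].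
  by apply: measurableT_comp; [exact: normr_measurable|exact: measurable_sndR].
rewrite integral_uniform01; apply: eq_integral => x /set_mem x01.
have /andP[x0 x1] : (0 <= toR x <= 1)%R by [].
rewrite EFinM kernel_momentK//.
rewrite -ge0_integralZl//; last 3 first.
- by apply/measurable_EFinP; exact: measurable_funX.
- by move=> y /=; rewrite in_itv/= => /andP[y0 _]; rewrite lee_fin exprn_ge0.
- by rewrite lee_fin exprn_ge0.
apply: eq_integral => y; rewrite inE/= in_itv/= => /andP[y0 _].
by rewrite /fstR /sndR/= !ger0_norm.
Qed.

End kernel_moments.

Section equal_densities.
Context (R : realType) (Z1 Z2 : R -> R -> R).
Hypotheses (hZ1 : limit_permutation Z1) (hZ2 : limit_permutation Z2).
Local Open Scope ereal_scope.
Notation u := (@fstR R).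
Notation v := (@sndR R).

Definition disagreement : set R :=
  [set x : R | (0 <= x <= 1)%R /\
     exists y : R, (0 <= y <= 1)%R /\ Z1 x y <> Z2 x y].

Lemma cdf_moments_determine (F1 F2 : R -> R) : is_cdf F1 -> is_cdf F2 ->
  (forall i, \int[cdf_measure F1]_(y in `[0%R, 1%R]%classic) (y ^+ i)%:E =
             \int[cdf_measure F2]_(y in `[0%R, 1%R]%classic) (y ^+ i)%:E) ->
  forall y : R, (0 <= y <= 1)%R -> F1 y = F2 y.
Proof.
move=> hF1 hF2 F12 y /andP[y0 y1].
have c01 (t : R) : (`[0%R, 1%R]%classic : set R) t -> (0 <= (cst 1 t : R) <= 1)%R.
  by rewrite /= ler01 lexx.
have mc1 : measurable_fun (`[0%R, 1%R]%classic : set (measurableTypeR R))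
    (cst (1 : R)%R) by exact: measurable_cst.
have id01 (t : R) : (`[0%R, 1%R]%classic : set R) t -> (0 <= (id t : R) <= 1)%R.
  by rewrite /= in_itv.
have m12 i : \int[cdf_measure F1]_(t in `[0%R, 1%R]%classic)
    (id t ^+ i * (cst 1 t : R))%:E =
    \int[cdf_measure F2]_(t in `[0%R, 1%R]%classic) (id t ^+ i * (cst 1 t : R))%:E.
  under eq_integral do rewrite /= mulr1.
  by under [RHS]eq_integral do rewrite /= mulr1.
have := @moments_below _ (measurableTypeR R) R `[0%R, 1%R]%classic id
  (measurable_itv _) (@measurable_id _ (measurableTypeR R) _) id01
  (cdf_measure F1) (cdf_measure F2) (cst 1%R) (cst 1%R)
  mc1 c01 mc1 c01 m12 y.
have mB : measurable (`[0%R, 1%R]%classic `&` `]-oo, y[%classic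
    : set (measurableTypeR R)) by exact: measurableI.
rewrite (_ : [set t : R | (id t < y)%R] = `]-oo, y[%classic); last first.
  by apply/seteqP; split => t; rewrite /= in_itv.
have cstE (F : R -> R) : \int[cdf_measure F]_(t in
    `[0%R, 1%R]%classic `&` `]-oo, y[%classic) (cst (1 : R)%R t)%:E =
    cdf_measure F (`[0%R, 1%R]%classic `&` `]-oo, y[%classic).
  by rewrite -[RHS]mul1e -integral_cst.
rewrite !cstE setIC -!cdf_measure_setI01// !cdf_measure_below// y1.
case: ifPn => [y0' _|_ [//]].
have -> : y = 0%R by apply/eqP; rewrite eq_le y0'.
by rewrite (cdf_at0 hF1) (cdf_at0 hF2).
Qed.

(** For each [b] the kernel moments of order [b] have the same integrals against
    all powers of [x], hence are equal almost everywhere; there are countably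
    many [b], so almost every [x] has all its kernel moments equal, and these
    determine the cdf. *)
Lemma equal_densities_ae :
  (forall n (tau : 'S_n.+1), limit_density tau Z1 = limit_density tau Z2) ->
  {ae uniform01 R, forall x : lebesgue_type R, unitT R x ->
    forall y : R, (0 <= y <= 1)%R -> Z1 (toR x) y = Z2 (toR x) y}.
Proof.
move=> d12.
have aeF : Filter (nbhs (almost_everywhere (uniform01 R))).
  exact: ae_filter_ringOfSetsType.
have patterns n (s : 'S_n.+1) :
    tprob (fun _ : 'I_n.+1 => permuton hZ1) (sorted_by u v 1%g s) =
    tprob (fun _ : 'I_n.+1 => permuton hZ2) (sorted_by u v 1%g s).
  have := d12 _ (s^-1)%g; rewrite !limit_densityE invgK.
  have m0 : ((n.+1)`!%:R != 0 :> R)%R by rewrite pnatr_eq0 -lt0n fact_gt0.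
  move=> /(mulfI m0) e; move: (congr1 EFin e).
  have mS : measurable (sorted_by u v 1%g s).
    by apply: measurable_sorted_by; [exact: measurable_fstR|exact: measurable_sndR].
  rewrite fineK; last exact: (fin_num_measure (tprob _) _ mS).
  by rewrite fineK; last exact: (fin_num_measure (tprob _) _ mS).
have moments := moments_of_patterns (@measurable_fstR R) (@measurable_sndR R)
  (permuton_uniform_fst hZ1) (permuton_uniform_snd hZ1)
  (permuton_uniform_fst hZ2) (permuton_uniform_snd hZ2) patterns.
have ae_moments b : {ae uniform01 R, forall x, unitT R x ->
    kernel_moment Z1 b x = kernel_moment Z2 b x}.
  apply: integrals_determine_ae.
  - exact: measurable_kernel_moment.
  - exact: measurable_kernel_moment.
  - exact: kernel_moment01.
  - exact: kernel_moment01.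
  - apply: (moments_below (@measurable_unitT R)).
    + by apply: measurable_funTS; exact: measurable_toR.
    + by [].
    + exact: measurable_kernel_moment.
    + exact: kernel_moment01.
    + exact: measurable_kernel_moment.
    + exact: kernel_moment01.
    + by move=> a; have := moments a b; rewrite !permuton_moment.
have := ae_foralln ae_moments; apply: filterS => x mx x01.
apply: cdf_moments_determine.
- exact: (limperm_cdf hZ1 x01).
- exact: (limperm_cdf hZ2 x01).
- move=> b; rewrite -(kernel_momentK hZ1 b x01) -(kernel_momentK hZ2 b x01).
  by rewrite mx.
Qed.

Lemma disagreement_null :
  (forall n (tau : 'S_n.+1), limit_density tau Z1 = limit_density tau Z2) ->
  leb R disagreement = 0.
Proof.
move=> /equal_densities_ae[N [mN N0 aeN]].
have sub : disagreement `<=` (N `&` unitT R : set (lebesgue_type R)).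
  move=> x [x01 [y [y01 Zxy]]]; split => //; apply: aeN => /= h.
  by apply: Zxy; apply: h.
have mI : measurable (N `&` unitT R).
  by apply: measurableI => //; exact: measurable_unitT.
have nI : (leb R).-negligible disagreement.
  by exists (N `&` unitT R); split.
have mD : @measurable _ (lebesgue_type R) disagreement.
  exact: (@completed_lebesgue_measure_is_complete R _ nI).
exact: (measure_negligible mD nI).
Qed.


(** Sets of outer measure 0 satisfy the criterion of Caratheodory. *)
Lemma leb0_measurable (N : set (lebesgue_type R)) : leb R N = 0 -> measurable N.
Proof.
move=> N0; apply: le_caratheodory_measurable => /= X.
rewrite (_ : ((wlength idfun)^*)%mu (X `&` N) = 0); last first.
  apply/eqP; rewrite eq_le outer_measure_ge0 andbT -N0.
  by apply: le_outer_measure; exact: subIsetr.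
by rewrite add0e; apply: le_outer_measure; exact: subIsetl.
Qed.

(** The intervals that characterise the measure of a cdf have end points in
    [0, 1]. *)
Lemma cdf_measure_ext (F1 F2 : R -> R) :
  (forall y : R, (0 <= y <= 1)%R -> F1 y = F2 y) ->
  cdf_measure F1 = cdf_measure F2.
Proof.
move=> F12; rewrite /cdf_measure; congr (xget _ _); apply/seteqP.
by split => mu [mu1 muF]; split => // a b a0 ab b1;
  rewrite muF// !F12// ?a0 ?b1 ?(le_trans a0 (ltW ab)) ?(le_trans (ltW ab) b1).
Qed.

Lemma permuton_eq (A : set (lebesgue_type R * measurableTypeR R)) :
  leb R disagreement = 0 -> measurable A ->
  permuton hZ1 A = permuton hZ2 A.
Proof.
move=> N0 mA; have mN := leb0_measurable N0.
have mf : measurable_fun setT (fun p => (\1_A p)%:E : \bar R).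
  exact/measurable_EFinP.
have f0 p : 0 <= (\1_A p)%:E :> \bar R by rewrite lee_fin.
have permE Z (hZ : limit_permutation Z) : permuton hZ A =
    \int[uniform01 R]_x \int[limit_kernel Z x]_y (\1_A (x, y))%:E.
  rewrite -[in LHS](setIT A) -integral_indic//.
  exact: (integral_joint_law (uniform01 R) (measurable_limit_kernel hZ) f0 mf).
rewrite (permE _ hZ1) (permE _ hZ2).
apply: ge0_ae_eq_integral; first exact: measurableT.
- exact: (measurable_integral_kernel (measurable_limit_kernel hZ1) f0 mf).
- exact: (measurable_integral_kernel (measurable_limit_kernel hZ2) f0 mf).
- by move=> x _; exact: integral_ge0.
- by move=> x _; exact: integral_ge0.
exists disagreement; split; first exact: mN.
  apply/eqP; rewrite eq_le measure_ge0 andbT -N0.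
  rewrite -[leLHS]/(leb R (disagreement `&` unitT R)).
  apply: le_measure; [rewrite inE|rewrite inE; exact: mN|exact: subIsetl].
  by apply: measurableI; [exact: mN|exact: measurable_unitT].
move=> x /= nx; apply: contrapT => nNx; apply: nx => _.
suff -> : limit_kernel Z1 x = limit_kernel Z2 x by [].
rewrite /limit_kernel; case: ifPn => // x01; apply: cdf_measure_ext => y y01.
by apply: contrapT => Zxy; apply: nNx; split => //; exists y.
Qed.

Lemma equal_densities_of_null : leb R disagreement = 0 ->
  forall m (tau : 'S_m), limit_density tau Z1 = limit_density tau Z2.
Proof.
move=> N0 m tau; rewrite !limit_densityE; congr (_ * fine _)%R.
apply: tprob_unique => [A mA|].
  rewrite [LHS](tprob_box (fun=> permuton hZ1) mA).
  by apply: eq_bigr => i _; exact: permuton_eq.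
by apply: measurable_sorted_by; [exact: measurable_fstR|exact: measurable_sndR].
Qed.

End equal_densities.

Theorem theorem1p5 (R : realType) (Z1 Z2 : R -> R -> R)
    (hZ1 : limit_permutation Z1) (hZ2 : limit_permutation Z2)
    (len : nat -> nat) (hlen : forall n, (0 < len n)%N)
    (sigma : forall n, 'S_(len n))
    (hconv : convergent_perm_seq R sigma)
    (hlim : perm_seq_tends_to sigma Z1) :
  perm_seq_tends_to sigma Z2 <->
  @completed_lebesgue_measure R
    [set x : R | 0 <= x <= 1 /\ exists y : R, 0 <= y <= 1 /\ Z1 x y <> Z2 x y] = 0%E.
Proof.
split=> [hlim2|N0 m tau m0].
  apply: (disagreement_null hZ1 hZ2) => n tau.
  exact: (cvg_unique _ (hlim _ tau isT) (hlim2 _ tau isT)).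
rewrite -(equal_densities_of_null hZ1 hZ2 N0).
exact: hlim.
Qed.
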